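(* Let $\Lambda,\Delta<\mathbb{R}/\mathbb{Z}$ be finitely generated dense subgroups, and let $\widehat{\Lambda},\widehat{\Delta}<\mathbb{R}$ be their preimages under the quotient map $\mathbb{R}\to\mathbb{R}/\mathbb{Z}$. The following are equivalent. (i) There exists a group embedding of $\mathrm{IET}(\Lambda)$ into $\mathrm{IET}(\Delta)$. (ii) There exists $c\in(0,1]$ such that the homothety $\mathbb{R}\to\mathbb{R}$, $x\mapsto cx$, maps $\widehat{\Lambda}$ into $\widehat{\Delta}$.
   Context: $\mathrm{IET}$ is the group of interval exchange transformations of $\mathbb{R}/\mathbb{Z}$: piecewise continuous bijections of $\mathbb{R}/\mathbb{Z}$ with finitely many discontinuity points which are translations in restriction to each interval of continuity (with the usual convention that they are right-continuous, intervals being half-open $[a,b)$). For a finitely generated dense subgroup $\Lambda<\mathbb{R}/\mathbb{Z}$, $\mathrm{IET}(\Lambda)$ is the subgroup of elements of $\mathrm{IET}$ whose discontinuity points belong to $\Lambda$ and which coincide with a translation by an element of $\Lambda$ in restriction to every interval of continuity. *)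

(* Defs.v *)
From HB Require Import structures.
From mathcomp Require Import all_boot all_order all_algebra.
From mathcomp Require Import all_classical all_reals topology normedtype.
From mathcomp Require Import zify ring lra.

Set Implicit Arguments.
Unset Strict Implicit.
Unset Printing Implicit Defensive.

Import Order.TTheory GRing.Theory Num.Theory.
Import numFieldTopology.Exports numFieldNormedType.Exports.

Local Open Scope classical_set_scope.
Local Open Scope ring_scope.
Local Open Scope quotient_scope.

Section Bijections.
Variable T : Type.

(* Self-bijections of [T]; the group law is composition, [f * g] being
   [f \o g]. *)
Record bijection := Bijection {
  bij_fun :> T -> T;
  bij_funP : `[< bijective bij_fun >]
}.

HB.instance Definition _ := [isSub for bij_fun].
HB.instance Definition _ := gen_eqMixin bijection.
HB.instance Definition _ := gen_choiceMixin bijection.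

Lemma bijection_ext (f g : bijection) : f =1 g -> f = g.
Proof. by move=> fg; apply: val_inj; apply/funext. Qed.

Lemma bijectionP (f : bijection) : bijective f.
Proof. exact/asboolP/bij_funP. Qed.

Lemma bijection_inv_ex (f : bijection) :
  exists g : bijection, cancel f g /\ cancel g f.
Proof.
case: (bijectionP f) => g fK gK.
have gP : `[< bijective g >] by apply/asboolP; exists f.
by exists (Bijection gP).
Qed.

Definition bij_one : bijection := Bijection (asboolT (inv_bij (frefl id))).
Definition bij_mul (f g : bijection) : bijection :=
  Bijection (asboolT (bij_comp (bijectionP f) (bijectionP g))).
Definition bij_inv (f : bijection) : bijection :=
  sval (cid (bijection_inv_ex f)).

Lemma bij_invK (f : bijection) : cancel f (bij_inv f).
Proof. by rewrite /bij_inv; case: cid => g []. Qed.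

Lemma bij_invKV (f : bijection) : cancel (bij_inv f) f.
Proof. by rewrite /bij_inv; case: cid => g []. Qed.

Lemma bij_mulA : associative bij_mul.
Proof. by move=> f g h; apply: bijection_ext. Qed.
Lemma bij_mul1 : left_id bij_one bij_mul.
Proof. by move=> f; apply: bijection_ext. Qed.
Lemma bij_mulr1 : right_id bij_one bij_mul.
Proof. by move=> f; apply: bijection_ext. Qed.
Lemma bij_mulV : left_inverse bij_one bij_inv bij_mul.
Proof. by move=> f; apply: bijection_ext => x /=; rewrite bij_invK. Qed.
Lemma bij_mulrV : right_inverse bij_one bij_inv bij_mul.
Proof. by move=> f; apply: bijection_ext => x /=; rewrite bij_invKV. Qed.

HB.instance Definition _ := isGroup.Build bijection
  bij_mulA bij_mul1 bij_mulr1 bij_mulV bij_mulrV.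

End Bijections.

Section Circle.
Variable R : realType.

(* [Num.int] is a qualifier; the [zmodClosed] instance is carried by the
   underlying predicate. *)
Definition circle_int : zmodClosed R := (Num.int_num_subdef : {pred R}).

(* The additive group R/Z with the quotient topology. *)
Definition circle : Type := quotient_topology (Quotient.quot circle_int).

HB.instance Definition _ := Topological.on circle.
HB.instance Definition _ := Quotient.on circle.
HB.instance Definition _ := GRing.isZmodule.Build circle
  (@Quotient.addqA R circle_int) (@Quotient.addqC R circle_int)
  (@Quotient.add0q R circle_int) (@Quotient.addNq R circle_int).

Definition circle_pi : R -> circle := \pi_circle.

Lemma circle_piD x y : circle_pi (x + y) = circle_pi x + circle_pi y.
Proof. exact: (@Quotient.pi_add R circle_int). Qed.

Lemma circle_pi0 : circle_pi 0 = 0.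
Proof. by apply: (addrI (circle_pi 0)); rewrite -circle_piD !addr0. Qed.

Lemma circle_piN x : circle_pi (- x) = - circle_pi x.
Proof.
by apply: (addrI (circle_pi x)); rewrite -circle_piD !subrr circle_pi0.
Qed.

Lemma circle_pi_surj (c : circle) : exists x, circle_pi x = c.
Proof. by exists (repr c); rewrite /circle_pi reprK. Qed.

Lemma circle_piE x y : circle_pi x = circle_pi y <-> x - y \is a Num.int.
Proof.
have E := @Quotient.idealrBE R circle_int x y.
split=> [H|H].
  by have : x - y \in circle_int by rewrite E; apply/eqP.
have {}H : x - y \in circle_int by [].
by rewrite E in H; move/eqP: H.
Qed.

Lemma nbhs_circle_pi x (U : set circle) :
  nbhs (circle_pi x) U <->
  exists2 e : R, 0 < e & forall y, `|y - x| < e -> U (circle_pi y).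
Proof.
split.
  move=> /(@pi_continuous _ (Quotient.quot circle_int) x).
  change (nbhs x (circle_pi @^-1` U) -> exists2 e : R, 0 < e &
    forall y, `|y - x| < e -> U (circle_pi y)).
  move=> /nbhs_ballP[e e0 H]; exists e => // y yx.
  by apply: H; rewrite /ball/= distrC.
case=> e e0 H; rewrite nbhsE.
exists (circle_pi @` ball x e); last first.
  by move=> _ [y yx <-]; apply: H; rewrite distrC.
split; last by exists x => //; exact: ballxx.
change (open (circle_pi @^-1` (circle_pi @` ball x e))).
rewrite openE => z [y yx] /circle_piE yz.
have /nbhs_ballP[d /= d0 Hd] : nbhs y (ball x e).
  by apply: open_nbhs_nbhs; split => //; exact: ball_open.
apply/nbhs_ballP; exists d => // w zw.
exists (w + (y - z)); last by apply/circle_piE; rewrite addrAC subrr add0r.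
apply: Hd; rewrite /ball/= in zw *.
by rewrite (_ : y - (w + (y - z)) = z - w)//; ring.
Qed.

Lemma near_circle_pi (x : R) (d : circle) :
  exists2 e : R, 0 < e & forall y, `|y - x| < e -> y != x -> circle_pi y <> d.
Proof.
have [r <-] := circle_pi_surj d.
have key (n : int) (k : R) : n%:~R < k -> k < (n + 1)%:~R ->
    k \is a Num.int -> False.
  by move=> + + /intrP[m Em]; rewrite Em !ltr_int => *; lia.
have [/intrP[n xr]|xr] := boolP (x - r \is a Num.int).
  exists 1 => // y; rewrite ltr_norml => /andP[y1 y2] yx /circle_piE yr.
  have {yr} : y - x \is a Num.int.
    rewrite (_ : y - x = (y - r) - (x - r)); last by rewrite opprB addrA subrK.
    by apply: rpredB => //; rewrite xr intr_int.
  move: yx; rewrite -subr_eq0; case: (ltgtP (y - x) 0) => // yx _.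
    by apply: (key (-1)) => //; rewrite addNr.
  exact: (key 0).
have /andP[n1 n2] := floor_itv (x - r); set n := Num.floor _ in n1 n2.
have {}n1 : n%:~R < x - r.
  by rewrite lt_neqAle n1 andbT; apply: contra xr => /eqP <-; rewrite intr_int.
exists (Num.min (x - r - n%:~R) ((n + 1)%:~R - (x - r))).
  by rewrite lt_min !subr_gt0 n1.
move=> y; rewrite lt_min !ltr_norml => /andP[/andP[y1 _] /andP[_ y2]] _.
by move=> /circle_piE; apply: (key n); lra.
Qed.

Lemma circle_sep (d : circle) : d != 0 ->
  exists2 e : R, 0 < e & forall u, `|u| < e -> circle_pi u <> d.
Proof.
move=> d0; have [e e0 H] := near_circle_pi 0 d; exists e => // u ue.
have [->|u0] := eqVneq u 0; first by move=> d1; rewrite -d1 circle_pi0 eqxx in d0.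
by apply: H => //; rewrite subr0.
Qed.

Implicit Types (f : circle -> circle) (a b x y : R).

Definition discontinuities f : set circle :=
  [set x : circle | ~ {for x, continuous f}].

(* The half-open interval of the circle is given by a lift [a, b[ to R, which
   may cross 0. Continuity is required on the open interval ]a, b[ only: [a] is
   allowed to be a discontinuity point. *)
Definition continuity_interval f a b :=
  a < b /\ forall x, a < x < b -> {for circle_pi x, continuous f}.

(* The left end point [a] is included, so that an f satisfying [is_iet] below
   is right-continuous everywhere. *)
Definition translation_on f a b (t : circle) :=
  forall x, a <= x < b -> f (circle_pi x) = circle_pi x + t.

(* Bijectivity is not part of these two predicates: they are applied to
   elements of [bijection circle]. *)
Definition is_iet f :=
  finite_set (discontinuities f) /\
  forall a b, continuity_interval f a b -> exists t, translation_on f a b t.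

Definition is_iet_over (L : zmodClosed circle) f :=
  [/\ is_iet f,
      forall x : circle, discontinuities f x -> x \in L &
      forall a b, continuity_interval f a b ->
        exists2 t, t \in L & translation_on f a b t].

Definition IET_over (L : zmodClosed circle) : {pred bijection circle} :=
  fun f : bijection circle => `[< is_iet_over L f >].

Lemma continuity_left f a m t : a < m -> translation_on f a m t ->
  {for circle_pi m, continuous f} -> f (circle_pi m) = circle_pi m + t.
Proof.
move=> am ft fm; apply/eqP; rewrite -subr_eq0; apply: contraT => d0.
set d := (X in X != 0) in d0.
have [e e0 He] := circle_sep d0.
have [s Es] := circle_pi_surj (f (circle_pi m)).
have e2 : 0 < e / 2 by rewrite divr_gt0.
have : nbhs (circle_pi m) (f @^-1` (circle_pi @` ball s (e / 2))).
  apply: fm; rewrite -Es; apply/nbhs_circle_pi; exists (e / 2) => // y ys.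
  by exists y => //; rewrite /ball/= distrC.
move=> /nbhs_circle_pi[c c0 Hc].
pose y := Num.max a (m - Num.min c (e / 2) / 2).
have mn0 : 0 < Num.min c (e / 2) by rewrite lt_min c0.
have [mc me] : Num.min c (e / 2) <= c /\ Num.min c (e / 2) <= e / 2.
  by rewrite !ge_min !lexx orbT.
have ay : a <= y by rewrite le_max lexx.
have ym : y < m by rewrite gt_max am/=; lra.
have my : m - Num.min c (e / 2) / 2 <= y by rewrite le_max lexx orbT.
have [|u su /esym] := Hc y; first by rewrite ltr_norml; apply/andP; split; lra.
rewrite ft ?ay// => Eu.
suff : circle_pi ((s - u) + (y - m)) <> d.
  case; rewrite !circle_piD !circle_piN -Eu Es /d -addrA; congr (_ + _).
  by rewrite !opprD addrACA addNr add0r addrC.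
apply: He; move: su; rewrite /ball/= !ltr_norml => /andP[su1 su2].
by apply/andP; split; lra.
Qed.

Lemma translation_continuous f x e t : 0 < e ->
  translation_on f (x - e) (x + e) t -> {for circle_pi x, continuous f}.
Proof.
move=> e0 ft; have [s Es] := circle_pi_surj t.
have fx : f (circle_pi x) = circle_pi (x + s).
  by rewrite circle_piD Es; apply: ft; apply/andP; split; lra.
move=> U; rewrite fx => /nbhs_circle_pi[c c0 Hc].
apply/nbhs_circle_pi; exists (Num.min c e); first by rewrite lt_min c0.
move=> y; rewrite lt_min => /andP[yc ye] /=.
have {}ye : x - e <= y < x + e.
  by move: ye; rewrite ltr_norml => /andP[? ?]; apply/andP; split; lra.
rewrite ft// -Es -circle_piD; apply: Hc.
by rewrite (_ : y + s - (x + s) = y - x)//; ring.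
Qed.

Lemma iet_near f x : finite_set (discontinuities f) ->
  exists2 e : R, 0 < e &
    forall y, `|y - x| < e -> y != x -> {for circle_pi y, continuous f}.
Proof.
move=> /finite_seqP[s Ds].
have [e e0 He] : exists2 e : R, 0 < e & forall y, `|y - x| < e -> y != x ->
    circle_pi y \notin s.
  elim: {f Ds} s => [|d s [e e0 He]]; first by exists 1.
  have [c c0 Hc] := near_circle_pi x d.
  exists (Num.min c e); first by rewrite lt_min c0.
  move=> y; rewrite lt_min => /andP[yc ye] yx; rewrite inE negb_or He// andbT.
  exact/eqP/Hc.
exists e => // y ye yx; apply: contrapT => fy.
have : discontinuities f (circle_pi y) by [].
by rewrite Ds /=; apply/negP/He.
Qed.

(* Local characterization of IET(L), used for the closure under the group
   operations. *)
Definition right_translation (L : zmodClosed circle) f :=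
  forall x, exists e t, [/\ 0 < e, t \in L & translation_on f x (x + e) t].

Lemma is_iet_overP (L : zmodClosed circle) f :
  is_iet_over L f <->
  [/\ finite_set (discontinuities f),
      forall x : circle, discontinuities f x -> x \in L &
      right_translation L f].
Proof.
split=> [[[ff _] fL ft]|[ff fL ft]].
  split=> // x; have [e e0 He] := iet_near x ff.
  have [|t tL tt] := ft x (x + e).
    split=> [|y /andP[xy ye]]; first lra.
    by apply: He; [rewrite ltr_norml; apply/andP; split; lra|rewrite gt_eqF].
  by exists e, t.
suff H a b : continuity_interval f a b ->
    exists2 t, t \in L & translation_on f a b t.
  by split=> //; split=> // a b /H[t _ ?]; exists t.
case=> ab fab; have [e [t [e0 tL te]]] := ft a; exists t => //.
apply: contrapT => nt.
pose A := [set y | a <= y < b /\ f (circle_pi y) <> circle_pi y + t].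
have [y0 [/andP[ay0 y0b] y0t]] : A !=set0.
  apply: contrapT => A0; apply: nt => y yab; apply: contrapT => yt.
  by apply: A0; exists y.
have lbA : lbound A (a + e).
  move=> y [/andP[ay yb] yt]; rewrite leNgt; apply/negP => ye.
  by apply: yt; apply: te; rewrite ay.
have A0 : A !=set0 by exists y0; split => //; rewrite ay0.
have infA : has_inf A by split=> //; exists (a + e).
pose m := inf A.
have am : a + e <= m by exact: lb_le_inf.
have my0 : m <= y0 by apply: ge_inf; [case: infA | split => //; rewrite ay0].
have ftm : translation_on f a m t.
  move=> y /andP[ay ym]; apply: contrapT => yt; suff : m <= y by lra.
  by apply: ge_inf; [case: infA | split => //; apply/andP; split; lra].
have mt : f (circle_pi m) = circle_pi m + t.
  apply: (@continuity_left _ a) => //; first lra.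
  by apply: fab; apply/andP; split; lra.
have [c [t' [c0 _ tc]]] := ft m.
have tt' : t' = t.
  by apply: (addrI (circle_pi m)); rewrite -mt tc//; apply/andP; split; lra.
have [y [/andP[ay yb] yt] ymc] : exists2 y, A y & y < m + c.
  by apply: inf_adherent.
apply: (yt); rewrite -tt'; apply: tc; rewrite ymc andbT.
by apply: ge_inf; [case: infA | split => //; rewrite ay].
Qed.

Lemma right_translationL (L : zmodClosed circle) f (z : circle) :
  right_translation L f -> (f z \in L) = (z \in L).
Proof.
have [x <-] := circle_pi_surj z => /(_ x)[e [t [e0 tL ->]]].
  by rewrite rpredDr.
by apply/andP; split; lra.
Qed.

Lemma IET_over_closed (L : zmodClosed circle) : group_closed (IET_over L).
Proof.
have one : (1 : bijection circle)%g \in IET_over L.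
  apply/asboolP/is_iet_overP.
  have D0 : discontinuities id = set0.
    by apply/seteqP; split=> // x; apply; move=> U.
  split; rewrite ?D0 // => x; exists 1, 0; split=> //; first exact: rpred0.
  by move=> y _; rewrite addr0.
split => // f g /asboolP/is_iet_overP[ff fL ft] /asboolP[[gf gI] gL gt].
have /is_iet_overP[_ _ gr] : is_iet_over L g by [].
pose h := (g^-1)%g : bijection circle.
have gK : cancel g h by exact: bij_invK.
have hK : cancel h g by exact: bij_invKV.
have hr : right_translation L h.
  move=> x; have [y Ey] := circle_pi_surj (h (circle_pi x)).
  have [e [t [e0 tL te]]] := gr y.
  exists e, (- t); split; rewrite ?rpredN// => x' /andP[xx' x'e].
  have gy : circle_pi x = circle_pi y + t.
    by rewrite -[LHS]hK -Ey te//; apply/andP; split; lra.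
  have -> : circle_pi x' = g (circle_pi (y + (x' - x))).
    rewrite te; last by apply/andP; split; lra.
    by rewrite !circle_piD circle_piN addrAC -gy addrC subrK.
  rewrite gK te; first by rewrite addrK.
  by apply/andP; split; lra.
have hd z : discontinuities h z -> discontinuities g (h z).
  move=> hz gz; apply: hz; have [x Ex] := circle_pi_surj (h z).
  have [e e0 He] := iet_near x gf.
  have [|t _ te] := gt (x - e) (x + e).
    split=> [|y /andP[y1 y2]]; first lra.
    have [->|yx] := eqVneq y x; first by rewrite Ex.
    by apply: He => //; rewrite ltr_norml; apply/andP; split; lra.
  have [s Es] := circle_pi_surj t.
  have zE : z = circle_pi (x + s).
    by rewrite circle_piD Es -te ?Ex ?hK//; apply/andP; split; lra.
  rewrite zE; apply: (@translation_continuous _ _ e (- t)) => // y yxs.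
  have -> : circle_pi y = g (circle_pi (y - s)).
    by rewrite te ?circle_piD ?circle_piN ?Es ?subrK//; apply/andP; split; lra.
  rewrite gK te ?addrK//; apply/andP; split; lra.
apply/asboolP/is_iet_overP; change (f / g)%g with (bij_mul f h).
have fhd z : discontinuities (f \o h) z ->
    discontinuities h z \/ discontinuities f (h z).
  move=> fhz; have [hz|] := pselect (discontinuities h z); [by left|right].
  move=> fz; apply: fhz; apply: continuous_comp => //.
  exact: contrapT.
split.
- apply: (@sub_finite_set _ _
    (h @^-1` (discontinuities g `|` discontinuities f))).
    by move=> z /fhd[/hd|]; [left|right].
  apply: finite_preimage; last by rewrite finite_setU.
  by move=> x y _ _ /(can_inj hK).
- move=> z /fhd[/hd/gL|/fL]; by rewrite (right_translationL _ hr).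
- move=> x; have [e [t [e0 tL te]]] := hr x.
  have [s Es] := circle_pi_surj t.
  have [c [u [c0 uL uc]]] := ft (x + s).
  exists (Num.min e c), (t + u); split; rewrite ?rpredD ?lt_min ?e0//.
  move=> y /andP[xy ye].
  have [ee ec] : Num.min e c <= e /\ Num.min e c <= c.
    by rewrite !ge_min !lexx orbT.
  rewrite /= te; last by apply/andP; split; lra.
  rewrite -Es -circle_piD uc ?circle_piD ?addrA//.
  by apply/andP; split; lra.
Qed.

Definition IET_group (L : zmodClosed circle) : Type :=
  {f : bijection circle | f \in IET_over L}.

HB.instance Definition _ (L : zmodClosed circle) :=
  SubChoice.on (IET_group L).
HB.instance Definition _ (L : zmodClosed circle) :=
  SubChoice_isSubGroup.Build _ _ (IET_group L) (@IET_over_closed L).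

Definition finitely_generated (L : zmodClosed circle) :=
  exists m (s : m.-tuple circle), forall x : circle, x \in L <-> inIntSpan s x.

Definition dense_subgroup (L : zmodClosed circle) :=
  dense [set x : circle | x \in L].

Definition circle_preimage (L : zmodClosed circle) : {pred R} :=
  [pred x : R | circle_pi x \in L].

End Circle.

(* Main.v *)
Require Import Defs.
From HB Require Import structures.
From mathcomp Require Import all_boot all_order all_algebra.
From mathcomp Require Import all_classical all_reals topology normedtype.
From mathcomp Require Import measure lebesgue_measure.
From mathcomp Require Import zify ring lra.

Set Implicit Arguments.
Unset Strict Implicit.
Unset Printing Implicit Defensive.

Import Order.TTheory GRing.Theory Num.Theory.
Import numFieldTopology.Exports numFieldNormedType.Exports.
Local Open Scope classical_set_scope.
Local Open Scope ring_scope.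

(** From a homothety to an embedding.  If [x |-> c * x] maps the preimage of
   [Lambda] into that of [Delta], conjugating by it turns an interval exchange
   over [Lambda] into one of [0, c[ over [Delta], extended by the identity; its
   pieces are those of the given one, scaled ([homothety_embedding]).  Here [c]
   itself is a break point, and it is allowed because 1 lies in the preimage of
   [Lambda].

   From an embedding [phi] to a homothety.  The basic elements are the 3-cycles
   of three contiguous intervals of length [t].  They have two virtues: two of
   them with the same [t] are conjugate by an element supported near both
   ([cyc_transport]), and the 3-cycle of length [s + t] is conjugate to a product
   of disjoint 3-cycles of lengths [s] and [t] ([cyc_divide]).  Let IET(Lambda)
   act on the circle through [phi].  The proof measures the sets of points moved
   by the images of 3-cycles.  These are finite unions of intervals with end
   points in [Delta], so their lengths lie in the preimage of [Delta].

   The key fact ([moved_size]) is that the images of disjoint 3-cycles which move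
   a common point [x] are at most [m] in number, when [Delta] is generated by [m]
   elements.  Its source is growth: [m.+1] commuting elements produce about
   [N ^ m.+1] words of exponents less than [N], but a point has only [O (N ^ m)]
   images under them, because displacements lie in a group with [m] generators.
   Hence two words agree at [x] ([word_collision]).  Suppose that 3-cycles in
   [m.+1] disjoint intervals move [x].  By the collisions, in one of these
   intervals every element has a power which fixes [x] up to elements supported
   elsewhere ([power_fixed_mod]).  Irrational rotations have powers pushing a
   quarter of the interval off itself, and it follows that the stabiliser of [x]
   among the elements supported in that quarter is normal there
   ([fixer_normal]).  Collisions applied inside the quarter show that this
   stabiliser is not trivial, commutators then give short 3-cycles in it, and
   these generate all the 3-cycles: none of them can move [x] ([active_bound]).

   Choose now a family of disjoint 3-cycles of maximal size whose images move a
   common point.  Let one of them vary, inside its interval, and let [mu t] be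
   the length of the set of the points moved by the others and by the varying
   3-cycle of length [t].  Conjugation shows that [mu t] does not depend on the
   place of the 3-cycle, and maximality that the sets of two disjoint 3-cycles
   are disjoint.  So [mu] is additive, hence linear ([additive_linear]).  An
   element of order 3 permutes the points that it moves in orbits of size 3, so
   that a third of [mu t] is the length of the set of the lowest points of these
   orbits and lies in the preimage of [Delta] as well ([len_order3]).  Thus
   [mu t = 3 * (c * t)] with [c * t] in the preimage of [Delta].  If the family
   has one element, [t] may be taken close to 1/3, and [mu t <= 1] gives
   [c <= 1]; otherwise shortening another 3-cycle of the family makes [c] small
   ([embedding_homothety]). *)

(** * Coordinates on the circle *)

Section Coordinates.
Variable R : realType.
Implicit Types (x y a b : R) (z : circle R) (L : zmodClosed (circle R)).

(** The representative in [0, 1[. *)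
Definition crd z : R := let x := repr z in x - (Num.floor x)%:~R.

Lemma crd_itv z : 0 <= crd z < 1.
Proof.
rewrite /crd; have /andP[] := floor_itv (repr z : R).
by rewrite intrD => h1 h2; apply/andP; split; lra.
Qed.

Lemma crd_ge0 z : 0 <= crd z. Proof. by case/andP: (crd_itv z). Qed.
Lemma crd_lt1 z : crd z < 1. Proof. by case/andP: (crd_itv z). Qed.

Lemma crdK z : circle_pi (crd z) = z.
Proof.
rewrite -[RHS](@reprK _ (circle R)); apply/circle_piE.
by rewrite /crd addrAC subrr add0r rpredN intr_int.
Qed.

Lemma crd_inj : injective crd.
Proof. exact: can_inj crdK. Qed.

Lemma piK x : 0 <= x < 1 -> crd (circle_pi x) = x.
Proof.
move=> /andP[x0 x1]; have /circle_piE/intrP[n E] := crdK (circle_pi x).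
have /andP[c0 c1] := crd_itv (circle_pi x).
suff n0 : n = 0 by apply/eqP; rewrite -subr_eq0 E n0.
have h1 : n%:~R < 1%:~R :> R by rewrite -E; lra.
have h2 : (-1)%:~R < n%:~R :> R by rewrite -E mulrNz; lra.
by move: h1 h2; rewrite !ltr_int; lia.
Qed.

Lemma circle_pi_int (n : int) : circle_pi (n%:~R : R) = 0.
Proof. by rewrite -(circle_pi0 R); apply/circle_piE; rewrite subr0 intr_int. Qed.

(** ** The preimage in the line of a subgroup of the circle *)

Definition lifts L : {pred R} := circle_preimage L.

Lemma liftsE L x : (x \in lifts L) = (circle_pi x \in L).
Proof. by []. Qed.

Lemma lifts0 L : 0 \in lifts L. Proof. by rewrite liftsE circle_pi0 rpred0. Qed.
Lemma lifts1 L : 1 \in lifts L.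
Proof. by rewrite liftsE (circle_pi_int 1) rpred0. Qed.
Lemma liftsD L x y : x \in lifts L -> y \in lifts L -> x + y \in lifts L.
Proof. by rewrite !liftsE circle_piD; apply: rpredD. Qed.
Lemma liftsN L x : x \in lifts L -> - x \in lifts L.
Proof. by rewrite !liftsE circle_piN rpredN. Qed.
Lemma liftsB L x y : x \in lifts L -> y \in lifts L -> x - y \in lifts L.
Proof. by move=> *; apply: liftsD => //; apply: liftsN. Qed.
Lemma liftsMn L x n : x \in lifts L -> x *+ n \in lifts L.
Proof.
by move=> xL; elim: n => [|n IH]; rewrite ?lifts0// mulrS; apply: liftsD.
Qed.
Lemma liftsMnat L x n : x \in lifts L -> n%:R * x \in lifts L.
Proof. by rewrite mulr_natl; apply: liftsMn. Qed.
Lemma liftsMz L x (n : int) : x \in lifts L -> x *~ n \in lifts L.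
Proof.
by case: n => n xL; rewrite ?NegzE ?mulrNz -?pmulrn ?liftsN// liftsMn.
Qed.

Lemma crd_lifts L z : (crd z \in lifts L) = (z \in L).
Proof. by rewrite liftsE crdK. Qed.

Lemma lifts_dense L a b : dense_subgroup L -> a < b ->
  exists2 x, x \in lifts L & a < x < b.
Proof.
move=> Ld ab; pose c := (a + b) / 2; pose e := (b - a) / 2.
have e0 : 0 < e by rewrite /e; lra.
have : nbhs (circle_pi c) (@circle_pi R @` ball c e).
  by apply/nbhs_circle_pi; exists e => // y yc; exists y => //; rewrite /ball/= distrC.
rewrite nbhsE => -[U [Uo Uc] UB].
have [|u [Uu uL]] := Ld U _ Uo; first by exists (circle_pi c).
have [y yc Ey] := UB _ Uu; exists y; first by rewrite liftsE Ey.
by move: yc; rewrite /ball/= ltr_norml /c /e => /andP[? ?]; apply/andP; split; lra.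
Qed.

End Coordinates.

Ltac in_lifts :=
  repeat first [assumption | apply: liftsB | apply: liftsD | apply: liftsMnat].

(** * Interval exchanges in the coordinate *)

Section Action.
Variables (R : realType) (L : zmodClosed (circle R)).
Implicit Types (g h : IET_group L) (z : circle R) (x y a b : R).

Definition act g : circle R -> circle R := val g.

Lemma actM g h z : act (g * h)%g z = act g (act h z).
Proof. by []. Qed.

Lemma act1 z : act 1%g z = z.
Proof. by []. Qed.

Lemma actKV g z : act g (act g^-1%g z) = z.
Proof. by rewrite -actM mulgV act1. Qed.

Lemma actK g z : act g^-1%g (act g z) = z.
Proof. by rewrite -actM mulVg act1. Qed.

Lemma act_inj g : injective (act g).
Proof. exact: can_inj (actK g). Qed.

Lemma iet_ext g h : (forall z, crd (act g z) = crd (act h z)) -> g = h.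
Proof. by move=> gh; apply/val_inj/bijection_ext => z; apply/crd_inj/gh. Qed.

Lemma act_iet_over g : is_iet_over L (act g).
Proof. by have /asboolP := valP g. Qed.

Lemma act_memL g z : (act g z \in L) = (z \in L).
Proof. by have /is_iet_overP[_ _ /right_translationL->] := act_iet_over g. Qed.

(** ** Subdivisions of the unit interval *)

Definition apart (p q : R * R) := (p.2 <= q.1) || (q.2 <= p.1).

Definition subdivision (ps : seq (R * R)) :=
  [/\ forall p, p \in ps ->
        [/\ 0 <= p.1, p.1 < p.2, p.2 <= 1, p.1 \in lifts L & p.2 \in lifts L],
      pairwise apart ps &
      forall x, 0 <= x < 1 -> exists2 p, p \in ps & p.1 <= x < p.2].

Definition cut (d : R) (p : R * R) : seq (R * R) :=
  if p.1 < d < p.2 then [:: (p.1, d); (d, p.2)] else [:: p].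

Lemma cut_sub d p q : q \in cut d p -> p.1 <= q.1 /\ q.2 <= p.2.
Proof.
rewrite /cut; case: ifP => [/andP[h1 h2]|_]; rewrite !inE.
  by case/orP => /eqP->; rewrite lexx ltW.
by move=> /eqP->.
Qed.

Lemma subdivide (D : seq R) : (forall d, d \in D -> d \in lifts L) ->
  exists2 ps, subdivision ps &
    forall p d, p \in ps -> d \in D -> ~~ (p.1 < d < p.2).
Proof.
elim: D => [|d D IH] DL.
  exists [:: (0, 1)] => //; split=> // [p|x x01]; last first.
    by exists (0, 1) => //; rewrite mem_seq1.
  by rewrite inE => /eqP->; split=> //; [exact: lifts0|exact: lifts1].
have [|ps [ps1 ps2 ps3] psD] := IH; first by move=> e eD; apply: DL;
  rewrite inE eD orbT.
have dL : d \in lifts L by apply: DL; rewrite mem_head.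
exists (flatten (map (cut d) ps)); first split.
- move=> q /flatten_mapP[p pps]; have [p0 pp p1 pL pL'] := ps1 _ pps.
  rewrite /cut; case: ifP => [/andP[pd dp]|_]; rewrite !inE; last by move=> /eqP->.
  by case/orP => /eqP-> /=; split=> //; lra.
- elim: ps ps2 {ps1 ps3 psD} => //= p ps IHps /andP[pps psp].
  rewrite pairwise_cat IHps// andbT; apply/andP; split.
    apply/allrelP => q r /cut_sub[pq qp] /flatten_mapP[r' r'ps /cut_sub[r1 r2]].
    have := allP pps _ r'ps; rewrite /apart => /orP[] h; apply/orP; [left|right]; lra.
  by rewrite /cut; case: ifP => //=; rewrite /apart /= lexx.
- move=> x /ps3[p pps /andP[px xp]].
  have [h|h] := boolP (p.1 < d < p.2); last first.
    exists p; last by rewrite px.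
    by apply/flatten_mapP; exists p => //; rewrite /cut (negbTE h) mem_head.
  have [xd|dx] := ltP x d.
    exists (p.1, d); last by rewrite /= px.
    by apply/flatten_mapP; exists p => //; rewrite /cut h mem_head.
  exists (d, p.2); last by rewrite /= dx.
  by apply/flatten_mapP; exists p => //; rewrite /cut h !inE eqxx orbT.
move=> q e /flatten_mapP[p pps qp]; rewrite inE => /orP[/eqP->|eD].
  move: qp; rewrite /cut; case: ifPn => h; rewrite !inE; last by move=> /eqP->.
  by case/orP => /eqP-> /=; rewrite ltxx ?andbF.
have := psD _ _ pps eD; have [pq qp'] := cut_sub qp.
by rewrite !negb_and -!leNgt => /orP[] h; apply/orP; [left|right]; lra.
Qed.

(** ** Building interval exchanges from their coordinate expression *)

(** It suffices to know [F] on the intervals that contain no point of [D] in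
   their interior: these refine into the pieces of a subdivision, and only their
   left end points can be discontinuities. *)
Lemma iet_build (F F' : R -> R) (D : seq R) :
  (forall x, 0 <= x < 1 ->
     [/\ 0 <= F x < 1, 0 <= F' x < 1, F' (F x) = x & F (F' x) = x]) ->
  (forall d, d \in D -> d \in lifts L) ->
  (forall p q, 0 <= p -> p < q -> q <= 1 ->
     (forall d, d \in D -> ~~ (p < d < q)) ->
     exists2 t, t \in lifts L & forall y, p <= y < q -> F y = y + t) ->
  exists g, forall z, crd (act g z) = F (crd z).
Proof.
move=> FF' DL tr; have [ps [ps1 _ ps3] psD] := subdivide DL.
pose f (z : circle R) : circle R := circle_pi (F (crd z)).
pose f' (z : circle R) : circle R := circle_pi (F' (crd z)).
have fE z : crd (f z) = F (crd z) by rewrite piK//; have [] := FF' _ (crd_itv z).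
have fE' z : crd (f' z) = F' (crd z) by rewrite piK//; have [] := FF' _ (crd_itv z).
have fb : `[< bijective f >].
  apply/asboolP; exists f' => z; apply/crd_inj; rewrite ?(fE, fE');
  by have [] := FF' _ (crd_itv z).
have ft p : p \in ps ->
    exists2 t, t \in lifts L & translation_on f p.1 p.2 (circle_pi t).
  move=> pps; have [p0 pp p1 _ _] := ps1 _ pps.
  have [|t tL Ft] := tr _ _ p0 pp p1; first by move=> d; exact: psD.
  exists t => // y /andP[py yp]; rewrite /f piK; last by apply/andP; split; lra.
  by rewrite Ft ?py// circle_piD.
have disc z : discontinuities f z -> z \in [seq circle_pi p.1 | p <- ps].
  move=> fz; have [p pps /andP[pz zp]] := ps3 _ (crd_itv z).
  apply/mapP; exists p => //; rewrite -[LHS]crdK; congr circle_pi.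
  apply/eqP; rewrite eq_le pz andbT leNgt; apply/negP => zp1; apply: fz.
  rewrite -[z]crdK; have [t tL Ft] := ft _ pps.
  pose e := Num.min (crd z - p.1) (p.2 - crd z).
  have [e1 e2] : e <= crd z - p.1 /\ e <= p.2 - crd z.
    by rewrite /e !ge_min !lexx orbT.
  have e0 : 0 < e by rewrite /e lt_min; apply/andP; split; lra.
  apply: (@translation_continuous _ _ _ e (circle_pi t)) => // y /andP[y1 y2].
  by apply: Ft; apply/andP; split; lra.
have fI : is_iet_over L f.
  apply/is_iet_overP; split.
  - apply: (@sub_finite_set _ _ [set` [seq circle_pi p.1 | p <- ps]]) => //.
  - by move=> z /disc/mapP[p pps ->]; have [_ _ _] := ps1 _ pps.
  move=> x; have [p pps /andP[px xp]] := ps3 _ (crd_itv (circle_pi x)).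
  have [t tL Ft] := ft _ pps; set x0 := crd _ in px xp.
  exists (p.2 - x0), (circle_pi t); split=> //; first lra.
  move=> y /andP[xy yx].
  have -> : circle_pi y = circle_pi (x0 + (y - x)).
    by rewrite circle_piD crdK -circle_piD addrC subrK.
  by apply: Ft; apply/andP; split; lra.
have fI' : Bijection fb \in IET_over L by apply/asboolP.
by exists (@exist _ (fun f : bijection _ => f \in IET_over L) _ fI') => z; rewrite -fE.
Qed.

(** An interval exchange moves the coordinates of a piece by a real
   translation as soon as the piece contains in its interior neither a
   discontinuity nor the preimage of 0, where the coordinate jumps. *)
Lemma iet_pieces (gs : seq (IET_group L)) (D0 : seq R) :
  (forall d, d \in D0 -> d \in lifts L) ->
  exists2 ps, subdivision ps &
    (forall p d, p \in ps -> d \in D0 -> ~~ (p.1 < d < p.2)) /\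
    forall g p, g \in gs -> p \in ps -> forall x, p.1 <= x < p.2 ->
      crd (act g (circle_pi x)) = crd (act g (circle_pi p.1)) + (x - p.1).
Proof.
move=> D0L; have brk g : exists2 D : seq R, (forall d, d \in D -> d \in lifts L) &
    forall p : R * R, 0 <= p.1 -> p.1 < p.2 -> p.2 <= 1 ->
      (forall d, d \in D -> ~~ (p.1 < d < p.2)) ->
      forall x, p.1 <= x < p.2 ->
      crd (act g (circle_pi x)) = crd (act g (circle_pi p.1)) + (x - p.1).
  have [[/finite_seqP[s sE] gt] gL _] := act_iet_over g.
  exists (crd (act g^-1%g 0) :: [seq crd z | z <- s]).
    move=> d; rewrite inE => /orP[/eqP->|/mapP[z zs ->]].
      by rewrite crd_lifts act_memL rpred0.
    by rewrite crd_lifts; apply: gL; rewrite sE.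
  move=> [p q] /= p0 pq q1 Dpq.
  have [|t gpt] := gt p q.
    split=> // x /andP[px xq]; apply: contrapT => gx.
    have : discontinuities (act g) (circle_pi x) by [].
    rewrite sE /= => xs; have := Dpq x; rewrite px xq inE.
    have -> : x \in [seq crd z | z <- s].
      by apply/mapP; exists (circle_pi x) => //; rewrite piK//; apply/andP; split; lra.
    by rewrite orbT => /(_ isT).
  move=> x /andP[px xq]; set y0 := crd (act g (circle_pi p)).
  have gE y : p <= y < q -> act g (circle_pi y) = circle_pi (y0 + (y - p)).
    move=> ypq; rewrite gpt// circle_piD crdK gpt ?lexx//.
    by rewrite addrAC -circle_piD [p + _]addrC subrK.
  have y0E := crd_itv (act g (circle_pi p)); rewrite -/y0 in y0E.
  rewrite gE ?px// piK//; apply/andP; split; first by case/andP: y0E; lra.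
  rewrite ltNge; apply/negP => y1.
  have [y01 y02] := andP y0E.
  have xx : p < 1 - y0 + p < q by apply/andP; split; lra.
  have /(Dpq _)/negP[] : 1 - y0 + p \in crd (act g^-1%g 0) :: [seq crd z | z <- s].
    rewrite inE; apply/orP; left; apply/eqP; rewrite -[LHS]piK; last first.
      by apply/andP; split; lra.
    congr crd; apply: (@act_inj g); rewrite actKV gE; last by apply/andP; split; lra.
    by rewrite addrK addrC subrK (circle_pi_int _ 1).
  by [].
have [D Dgs] : exists D : seq R, (forall d, d \in D -> d \in lifts L) /\
    forall g, g \in gs -> forall p : R * R, 0 <= p.1 -> p.1 < p.2 -> p.2 <= 1 ->
      (forall d, d \in D -> ~~ (p.1 < d < p.2)) ->
      forall x, p.1 <= x < p.2 ->
      crd (act g (circle_pi x)) = crd (act g (circle_pi p.1)) + (x - p.1).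
  elim: gs => [|g gs [D [DL Dgs]]]; first by exists [::].
  have [D' DL' Dg] := brk g; exists (D' ++ D); split.
    by move=> d; rewrite mem_cat => /orP[/DL'|/DL].
  move=> h; rewrite inE => /orP[/eqP->|hgs] p p0 pq q1 Dp.
    by apply: Dg => // d dD; apply: Dp; rewrite mem_cat dD.
  by apply: Dgs => // d dD; apply: Dp; rewrite mem_cat dD orbT.
have [|ps psub psD] := @subdivide (D0 ++ D).
  by move=> d; rewrite mem_cat => /orP[/D0L//|/(Dgs.1)].
exists ps => //; split=> [p d pps dD|g p ggs pps].
  by apply: psD => //; rewrite mem_cat dD.
have [ps1 _ _] := psub; have [? ? ? _ _] := ps1 _ pps.
by apply: (Dgs.2) => // d dD; apply: psD => //; rewrite mem_cat dD orbT.
Qed.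

End Action.

(** * Rotations of subintervals *)

Section Rotations.
Variables (R : realType) (L : zmodClosed (circle R)).
Implicit Types (g h : IET_group L) (z : circle R) (x y a b l s t : R).

Definition rotF a l b x :=
  if (a <= x) && (x < a + l) then (if x + b < a + l then x + b else x + b - l)
  else x.

Definition rot_ok a l b :=
  [/\ 0 <= a, 0 <= b, b <= l, a + l <= 1 &
      [/\ a \in lifts L, l \in lifts L & b \in lifts L]].

Lemma rot_ex a l b : rot_ok a l b ->
  exists g, forall z, crd (act g z) = rotF a l b (crd z).
Proof.
move=> [a0 b0 bl al [aL lL bL]].
apply: (@iet_build _ _ _ (rotF a l (l - b)) [:: a; a + l; a + l - b]).
- move=> x /andP[x0 x1]; rewrite /rotF.
  split; repeat case: ifP; lra.
- move=> d; rewrite !inE => /or3P[] /eqP->//; first exact: liftsD.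
  by apply: liftsB => //; apply: liftsD.
move=> p q p0 pq q1 D.
have := D a; have := D (a + l); have := D (a + l - b); rewrite !inE !eqxx !orbT.
move=> /(_ isT) D3 /(_ isT) D2 /(_ isT) D1; rewrite /rotF.
have [ap|pa] := lerP a p; last first.
  by exists 0; [exact: lifts0|move=> y ?; case: ifP; lra].
have [pl|lp] := ltrP p (a + l); last first.
  by exists 0; [exact: lifts0|move=> y ?; case: ifP; lra].
have [pb|bp] := ltrP p (a + l - b).
  by exists b => // y ?; repeat case: ifP; lra.
by exists (b - l); [exact: liftsB|move=> y ?; repeat case: ifP; lra].
Qed.

(** Made total by the value 1, so that products of rotations can be written
   before their parameters are checked. *)
Definition irot a l b : IET_group L :=
  if pselect (exists g, forall z, crd (act g z) = rotF a l b (crd z)) is left e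
  then sval (cid e) else 1%g.

Lemma rotE a l b z : rot_ok a l b -> crd (act (irot a l b) z) = rotF a l b (crd z).
Proof.
move=> /rot_ex e; rewrite /irot; case: pselect => // {}e.
by case: cid => g /=.
Qed.

(** Rotating by a third of the length permutes cyclically [a, a + s[,
   [a + s, a + 2s[ and [a + 2s, a + 3s[. *)
Definition cyc a s := irot a (3 * s) s.

Definition cyc_ok a s :=
  [/\ 0 <= a, 0 <= s, a + 3 * s <= 1, a \in lifts L & s \in lifts L].

Lemma cyc_rot_ok a s : cyc_ok a s -> rot_ok a (3 * s) s.
Proof. by case=> a0 s0 as1 aL sL; split=> //; [lra|split=> //; apply: liftsMnat]. Qed.

Lemma cycE a s z : cyc_ok a s -> crd (act (cyc a s) z) = rotF a (3 * s) s (crd z).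
Proof. by move=> /cyc_rot_ok; apply: rotE. Qed.

Variant rotF_spec a l b x : R -> Prop :=
  | RotLow of x < a : rotF_spec a l b x x
  | RotHigh of a + l <= x : rotF_spec a l b x x
  | RotLeft of a <= x & x < a + l & x + b < a + l : rotF_spec a l b x (x + b)
  | RotRight of a <= x & x < a + l & a + l <= x + b : rotF_spec a l b x (x + b - l).

Lemma rotFP a l b x : rotF_spec a l b x (rotF a l b x).
Proof.
rewrite /rotF; have [ax|xa] /= := lerP a x; last exact: RotLow.
have [xl|lx] /= := ltrP x (a + l); last exact: RotHigh.
by have [h|h] := ltrP (x + b) (a + l); [apply: RotLeft|apply: RotRight].
Qed.

Lemma rotFlow a l b x : x < a -> rotF a l b x = x.
Proof. by move=> xa; rewrite /rotF leNgt xa. Qed.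

Lemma rotFhigh a l b x : a + l <= x -> rotF a l b x = x.
Proof. by move=> lx; rewrite /rotF [x < _]ltNge lx andbF. Qed.

Lemma rotFleft a l b x : a <= x -> 0 <= b -> x + b < a + l ->
  rotF a l b x = x + b.
Proof.
by move=> ax b0 xl; rewrite /rotF ax xl /= (le_lt_trans _ xl)// lerDl.
Qed.

Lemma rotFright a l b x : x < a + l -> b <= l -> a + l <= x + b ->
  rotF a l b x = x + b - l.
Proof.
move=> xl bl lx; rewrite /rotF xl [_ < _]ltNge lx/= andbT ifT//.
by rewrite -(lerD2r l) (le_trans lx)// lerD2l.
Qed.

(* Case analysis on the innermost rotations, with early pruning. *)
Ltac rotstep := match goal with |- context [rotF ?a ?l ?b ?x] =>
  lazymatch x with context [rotF] => fail | _ =>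
  case: (rotFP a l b x) => *; try (exfalso; lra) end end.
Ltac rotin e lem := match e with context [rotF ?a ?l ?b ?x] =>
  lazymatch x with context [rotF] => fail | _ =>
  rewrite (lem a l b x); [|lra..] end end.
(* Evaluates the innermost rotation on the left, resp. right hand side. *)
Ltac evl lem := match goal with |- ?e = _ => rotin e lem end.
Ltac evr lem := match goal with |- _ = ?e => rotin e lem end.
Ltac rotlra := repeat rotstep; lra.

(** [h] maps the interval onto its translate, hence the complement into the
   complement, where both rotations are the identity. *)
Lemma rot_conj h a a' l b : rot_ok a l b -> rot_ok a' l b ->
    (forall z, a <= crd z < a + l -> crd (act h z) = crd z + (a' - a)) ->
  (h * irot a l b = irot a' l b * h)%g.
Proof.
move=> ok ok' ht; apply: iet_ext => z; rewrite !actM rotE//.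
have [a0 b0 bl al _] := ok; have [a0' _ _ al' _] := ok'.
have [zin|zout] := boolP (a <= crd z < a + l).
  have zin' : a <= crd (act (irot a l b) z) < a + l.
    by rewrite rotE// /rotF zin; case: ifP; lra.
  rewrite (ht _ zin) (ht _ zin') rotE//; move: zin => /andP[z1 z2].
  by case: (rotFP a l b) => *; case: rotFP => *; lra.
have -> : act (irot a l b) z = z.
  by apply/crd_inj; rewrite rotE// /rotF (negbTE zout).
rewrite /rotF ifF//; apply/negbTE/negP => /andP[h1 h2].
pose w : circle R := circle_pi (crd (act h z) - (a' - a)).
have cw : crd w = crd (act h z) - (a' - a).
  by rewrite /w piK//; apply/andP; split; lra.
have win : a <= crd w < a + l by rewrite cw; apply/andP; split; lra.
have wz : act h w = act h z by apply/crd_inj; rewrite ht// cw subrK.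
by move: zout; rewrite -(act_inj wz) win.
Qed.

(** A rotation of the interval spanned by two translates of an interval carries
   one onto the other by a translation, even when the translates overlap. *)
Lemma cyc_conj a a' s : a <= a' -> cyc_ok a s -> cyc_ok a' s ->
  let h := irot a (a' - a + 3 * s) (a' - a) in (h * cyc a s = cyc a' s * h)%g.
Proof.
move=> aa' ok ok' h.
have [a0 s0 as1 aL sL] := ok; have [a0' _ as1' aL' _] := ok'.
have hok : rot_ok a (a' - a + 3 * s) (a' - a).
  split; try lra; split; rewrite ?liftsB//; apply: liftsD; rewrite ?liftsB//.
  exact: liftsMnat.
apply: rot_conj => [||z /andP[az za]]; try exact: cyc_rot_ok.
by rewrite rotE//; case: rotFP; lra.
Qed.

(** Cutting each of the three intervals of a 3-cycle in two and sorting the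
   pieces yields two 3-cycles side by side. *)
Lemma cyc_split a s t : cyc_ok a (s + t) -> 0 <= s -> 0 <= t ->
    s \in lifts L -> t \in lifts L ->
  let h := (irot (a + 2 * s) (2 * t + s) s * irot (a + s) (t + s) s)%g in
  (h * cyc a (s + t) = cyc a s * cyc (a + 3 * s) t * h)%g.
Proof.
move=> ok s0 t0 sL tL h; apply: iet_ext => z; rewrite !actM.
have [a0 _ as1 aL _] := ok.
have ok1 : rot_ok (a + 2 * s) (2 * t + s) s.
  by split; try lra; split; rewrite ?liftsD ?liftsMnat.
have ok2 : rot_ok (a + s) (t + s) s by split; try lra; split; rewrite ?liftsD.
have ok3 : cyc_ok a s by split; try lra.
have ok4 : cyc_ok (a + 3 * s) t by split; try lra; rewrite ?liftsD ?liftsMnat.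
rewrite !(rotE, cycE)//; move: (crd z) => x; clear -a0 s0 t0 as1.
have [xa|ax] := ltrP x a; first by rewrite !rotFlow; lra.
have [x1|x1] := ltrP x (a + s).
  by evl rotFleft; evl rotFright; evl rotFlow; evr rotFlow; evr rotFlow; evr rotFlow;
    evr rotFleft; lra.
have [x2|x2] := ltrP x (a + s + t).
  by evl rotFleft; evl rotFhigh; evl rotFleft; evr rotFleft; evr rotFleft;
    evr rotFleft; evr rotFhigh; lra.
have [x3|x3] := ltrP x (a + s + t + s).
  by evl rotFleft; evl rotFhigh; evl rotFright; evr rotFright; evr rotFlow;
    evr rotFlow; evr rotFleft; lra.
have [x4|x4] := ltrP x (a + s + t + s + t).
  by evl rotFleft; evl rotFhigh; evl rotFhigh; evr rotFhigh; evr rotFleft;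
    evr rotFleft; evr rotFhigh; lra.
have [x5|x5] := ltrP x (a + s + t + s + t + s).
  by evl rotFright; evl rotFlow; evl rotFlow; evr rotFhigh; evr rotFright;
    evr rotFlow; evr rotFright; lra.
have [x6|x6] := ltrP x (a + s + t + s + t + s + t).
  by evl rotFright; evl rotFleft; evl rotFleft; evr rotFhigh; evr rotFhigh;
    evr rotFright; evr rotFhigh; lra.
by rewrite !rotFhigh; lra.
Qed.

Lemma cyc3 a s : cyc_ok a s -> (cyc a s * (cyc a s * cyc a s) = 1)%g.
Proof.
move=> ok; apply: iet_ext => z; rewrite !actM act1 !cycE//.
by have [a0 s0 as1 aL sL] := ok; rotlra.
Qed.

Lemma rot_invol a s : rot_ok a (2 * s) s -> (irot a (2 * s) s * irot a (2 * s) s = 1)%g.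
Proof.
move=> ok; apply: iet_ext => z; rewrite !actM act1 !rotE//.
by have [a0 s0 as1 aL sL] := ok; rotlra.
Qed.

(** A 3-cycle is the commutator of two transpositions of adjacent intervals. *)
Lemma cyc_comm a s : cyc_ok a s ->
  let p := irot a (2 * s) s in let q := irot (a + s) (2 * s) s in
  (cyc a s = q * (p * (q * p)))%g.
Proof.
move=> ok p q; apply: iet_ext => z; rewrite !actM.
have [a0 s0 as1 aL sL] := ok.
have ok1 : rot_ok a (2 * s) s by split; try lra; split; rewrite ?liftsMnat.
have ok2 : rot_ok (a + s) (2 * s) s by split; try lra; split;
  rewrite ?liftsD ?liftsMnat.
rewrite !(cycE, rotE)//; move: (crd z) => x; clear -a0 s0 as1.
have [xa|ax] := ltrP x a; first by rewrite !rotFlow; lra.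
have [x1|x1] := ltrP x (a + s).
  by evl rotFleft; evr rotFleft; evr rotFleft; evr rotFhigh; evr rotFright; lra.
have [x2|x2] := ltrP x (a + s + s).
  by evl rotFleft; evr rotFright; evr rotFlow; evr rotFleft; evr rotFleft; lra.
have [x3|x3] := ltrP x (a + s + s + s).
  by evl rotFright; evr rotFhigh; evr rotFright; evr rotFright; evr rotFlow; lra.
by rewrite !rotFhigh; lra.
Qed.

End Rotations.

(** * From a homothety to an embedding *)

Section Homothety.
Variables (R : realType) (L M : zmodClosed (circle R)) (c : R).
Hypotheses (c01 : 0 < c <= 1)
  (cLM : forall x : R, x \in lifts L -> c * x \in lifts M).
Implicit Types (g h : IET_group L) (x : R).

(** The conjugate of [g] by the homothety on [0, c[, and the identity above. *)
Definition scaleF g x : R :=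
  if x < c then c * crd (act g (circle_pi (x / c))) else x.

Lemma scaleF_lt g x : 0 <= x -> x < c -> 0 <= scaleF g x < c.
Proof.
move=> x0 xc; rewrite /scaleF xc; have /andP[c0 _] := c01.
have /andP[h1 h2] := crd_itv (act g (circle_pi (x / c))).
by rewrite mulr_ge0 ?(ltW c0)//= -[ltRHS]mulr1 ltr_pM2l.
Qed.

Lemma scaleF_itv g x : 0 <= x < 1 -> 0 <= scaleF g x < 1.
Proof.
move=> /andP[x0 x1]; have [xc|cx] := ltrP x c.
  have /andP[-> /= h] := scaleF_lt g x0 xc.
  by apply: lt_le_trans h _; case/andP: c01.
by rewrite /scaleF ltNge cx /= x0 x1.
Qed.

Lemma scaleFM g h x : 0 <= x < 1 -> scaleF g (scaleF h x) = scaleF (g * h)%g x.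
Proof.
move=> /andP[x0 x1]; have [xc|cx] := ltrP x c; last first.
  by rewrite /scaleF !ltNge cx /= cx.
have /andP[_ h2] := scaleF_lt h x0 xc; rewrite {1}/scaleF h2.
have cn0 : c != 0 by rewrite gt_eqF//; case/andP: c01.
by rewrite /scaleF xc [X in circle_pi X]mulrC mulKf// crdK.
Qed.

Lemma scaleF1 x : 0 <= x < 1 -> scaleF 1%g x = x.
Proof.
move=> /andP[x0 x1]; rewrite /scaleF; case: ifP => // xc.
have /andP[c0 _] := c01.
rewrite act1 piK; first by rewrite mulrC divfK// gt_eqF.
by rewrite divr_ge0 ?(ltW c0)//= ltr_pdivrMr// mul1r.
Qed.

Lemma scale_ex g : exists g' : IET_group M,
  forall z, crd (act g' z) = scaleF g (crd z).
Proof.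
have /andP[c0 c1] := c01; have cn0 : c != 0 by rewrite gt_eqF.
have [|ps [ps1 _ ps3] [_ gps]] := @iet_pieces _ _ [:: g] [::]; first by [].
have cM : c \in lifts M by rewrite -[c]mulr1 cLM// lifts1.
apply: (@iet_build _ _ _ (scaleF g^-1%g) (c :: [seq c * p.2 | p <- ps])).
- by move=> x x01; rewrite !scaleF_itv// !scaleFM// mulVg mulgV scaleF1.
- move=> d; rewrite inE => /orP[/eqP->//|/mapP[p pps ->]].
  by apply: cLM; have [] := ps1 _ pps.
move=> p q p0 pq q1 D; have [cp|pc] := lerP c p.
  exists 0; first exact: lifts0.
  by move=> y /andP[py yq]; rewrite /scaleF ltNge (le_trans cp py) addr0.
have qc : q <= c.
  by have := D c; rewrite mem_head pc -leNgt => /(_ isT).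
have pc01 : 0 <= p / c < 1.
  by rewrite divr_ge0 ?(ltW c0)//= ltr_pdivrMr// mul1r.
have [r rps /andP[rp pr]] := ps3 _ pc01; have [r0 rr r1 rL rL'] := ps1 _ rps.
have qr : q <= c * r.2.
  have := D (c * r.2); rewrite inE (map_f (fun r => c * r.2) rps) orbT.
  by rewrite mulrC -ltr_pdivrMr// pr/= -leNgt mulrC => /(_ isT).
exists (c * (crd (act g (circle_pi r.1)) - r.1)).
  by apply: cLM; apply: liftsB => //; rewrite crd_lifts act_memL.
move=> y /andP[py yq]; rewrite /scaleF (lt_le_trans yq qc).
rewrite (gps g r (mem_head _ _) rps); last first.
  rewrite (le_trans rp) ?ler_pM2r ?invr_gt0//= ltr_pdivrMr// mulrC.
  exact: lt_le_trans yq qr.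
by field.
Qed.

Definition scale g : IET_group M := sval (cid (scale_ex g)).

Lemma scaleE g z : crd (act (scale g) z) = scaleF g (crd z).
Proof. by rewrite /scale; case: cid. Qed.

Lemma scaleM : {morph scale : g h / (g * h)%g}.
Proof.
move=> g h; apply: iet_ext => z.
by rewrite actM !scaleE scaleFM// crd_itv.
Qed.

Lemma scale_inj : injective scale.
Proof.
have /andP[c0 c1] := c01; have cn0 : c != 0 by rewrite gt_eqF.
move=> g h gh; apply: iet_ext => z; have /andP[z0 z1] := crd_itv z.
pose w : circle R := circle_pi (c * crd z).
have cz : c * crd z < c by rewrite -[ltRHS]mulr1 ltr_pM2l.
have cw : crd w = c * crd z.
  by rewrite piK// mulr_ge0 ?(ltW c0)//= (lt_le_trans cz).
have : crd (act (scale g) w) = crd (act (scale h) w) by rewrite gh.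
by rewrite !scaleE cw /scaleF cz ![c * _ / c]mulrC mulKf// crdK => /(mulfI cn0).
Qed.

Lemma homothety_embedding : exists phi : {multiplicative IET_group L -> IET_group M},
  injective phi.
Proof.
pose m := isMultiplicative.Build _ _ scale scaleM.
pose phi : {multiplicative IET_group L -> IET_group M} := HB.pack scale m.
exists phi; exact: scale_inj.
Qed.

End Homothety.

(** * Supports *)

Section Supports.
Variables (R : realType) (L : zmodClosed (circle R)).
Implicit Types (g h : IET_group L) (E F : set (circle R)) (z : circle R).

Definition supp_in E g := forall z, ~ E z -> act g z = z.

Definition itv (a l : R) : set (circle R) := [set z | a <= crd z < a + l].

Lemma supp_in_act E g z : supp_in E g -> E z -> E (act g z).
Proof.
move=> gE Ez; apply: contrapT => nE.
by apply: (nE); rewrite (act_inj (gE _ nE)).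
Qed.

Lemma supp_in1 E : supp_in E 1%g. Proof. by []. Qed.

Lemma supp_inM E g h : supp_in E g -> supp_in E h -> supp_in E (g * h)%g.
Proof. by move=> gE hE z nE; rewrite actM hE// gE. Qed.

Lemma supp_inV E g : supp_in E g -> supp_in E g^-1%g.
Proof. by move=> gE z nE; rewrite -{1}(gE _ nE) actK. Qed.

Lemma supp_inX E g n : supp_in E g -> supp_in E (g ^+ n)%g.
Proof.
by move=> gE; elim: n => [|n IH]; rewrite ?expg0 ?expgS//; apply: supp_inM.
Qed.

Lemma sub_supp_in E F g : (forall z, E z -> F z) -> supp_in E g -> supp_in F g.
Proof. by move=> EF gE z nF; apply: gE => /EF. Qed.

Lemma supp_commute E F g h : (forall z, E z -> F z -> False) ->
  supp_in E g -> supp_in F h -> (g * h = h * g)%g.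
Proof.
move=> EF gE hF; apply: iet_ext => z; rewrite !actM.
have [Ez|nE] := pselect (E z); last first.
  rewrite (gE _ nE); have [Fz|nF] := pselect (F z); last by rewrite (hF _ nF) gE.
  by rewrite gE// => Ehz; apply: (EF _ Ehz); apply: supp_in_act.
have nF : ~ F z by move=> Fz; apply: EF Ez Fz.
have nF' : ~ F (act g z) by move=> Fz; apply: (EF (act g z)) => //; apply: supp_in_act.
by rewrite (hF _ nF) (hF _ nF').
Qed.

Lemma rot_supp a l b : rot_ok L a l b -> supp_in (itv a l) (irot L a l b).
Proof.
move=> ok z nz; apply/crd_inj; rewrite rotE// /rotF.
by rewrite (_ : _ && _ = false)//; apply/negbTE/negP.
Qed.

Lemma cyc_supp a s : cyc_ok L a s -> supp_in (itv a (3 * s)) (cyc L a s).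
Proof. by move=> /cyc_rot_ok; apply: rot_supp. Qed.

Lemma act_prod_disj (I : finType) (E : I -> set (circle R)) (f : I -> IET_group L) i z :
  (forall i j z, i != j -> E i z -> E j z -> False) ->
  (forall i, supp_in (E i) (f i)) -> E i z ->
  act (\prod_j f j)%g z = act (f i) z.
Proof.
move=> Edis fE Ez.
suff H (r : seq I) : uniq r -> act (\prod_(j <- r) f j)%g z =
    if i \in r then act (f i) z else z.
  by rewrite H ?index_enum_uniq// mem_index_enum.
elim: r => [|j r IH] /=; first by rewrite big_nil.
case/andP=> jr ur; rewrite big_cons actM IH// inE.
have [ij|ij] := eqVneq i j; first by subst j; rewrite (negbTE jr).
by case: ifP => _; rewrite fE// => Ej;
  apply: (Edis _ _ _ ij _ Ej) => //; apply: supp_in_act.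
Qed.

End Supports.

(** * Polynomial growth of the orbits *)

Section Pigeonhole.
Variables (R : realType) (M : zmodClosed (circle R)).
Variables (m : nat) (s : m.-tuple (circle R)).
Hypothesis Ms : forall z, z \in M -> inIntSpan s z.
Implicit Types (g h : IET_group M) (z : circle R).

Definition span_ball (C : nat) z :=
  exists2 a : int ^ m, (forall j, (absz (a j) <= C)%N) &
    z = \sum_(j < m) s`_j *~ a j.

Lemma span_ballD C C' z z' : span_ball C z -> span_ball C' z' ->
  span_ball (C + C') (z + z').
Proof.
move=> [a aC ->] [b bC ->]; exists [ffun j => a j + b j].
  by move=> j; rewrite ffunE; have := aC j; have := bC j; lia.
by rewrite -big_split; apply: eq_bigr => j _; rewrite ffunE mulrzDr.
Qed.

Lemma span_ball0 : span_ball 0 0.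
Proof.
exists [ffun=> 0]; first by move=> j; rewrite ffunE.
by rewrite big1// => j _; rewrite ffunE.
Qed.

Lemma span_ballW C C' z : (C <= C')%N -> span_ball C z -> span_ball C' z.
Proof.
by move=> CC' [a aC ->]; exists a => // j; apply: leq_trans (aC j) CC'.
Qed.

Definition moves_by (C : nat) g := forall z, span_ball C (act g z - z).

Lemma moves_byM C C' g h : moves_by C g -> moves_by C' h ->
  moves_by (C + C') (g * h)%g.
Proof.
move=> gC hC z; rewrite actM (_ : _ - _ = (act g (act h z) - act h z) + (act h z - z)).
  exact: span_ballD.
by rewrite addrA subrK.
Qed.

Lemma moves_by1 : moves_by 0 1%g.
Proof. by move=> z; rewrite act1 subrr; exact: span_ball0. Qed.

Lemma moves_byX C g n : moves_by C g -> moves_by (n * C) (g ^+ n)%g.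
Proof.
move=> gC; elim: n => [|n IH]; first exact: moves_by1.
by rewrite expgS mulSn; apply: moves_byM.
Qed.

(** There are finitely many pieces, and each is moved by one element of [M]. *)
Lemma moves_by_ex g : exists C, moves_by C g.
Proof.
have [|ps [ps1 _ ps3] [_ gps]] := @iet_pieces _ _ [:: g] [::]; first by [].
have tr p : p \in ps -> forall z, p.1 <= crd z < p.2 ->
    act g z - z = act g (circle_pi p.1) - circle_pi p.1.
  move=> pps z zp; rewrite -{1}[act g z]crdK -{1}[z]crdK.
  rewrite (gps _ _ (mem_head _ _) pps _ zp) circle_piD crdK circle_piD circle_piN.
  by rewrite crdK -addrA addrAC subrr add0r.
have [C HC] : exists C, forall p, p \in ps ->
    span_ball C (act g (circle_pi p.1) - circle_pi p.1).
  have {}ps1 p : p \in ps -> circle_pi p.1 \in M by case/ps1.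
  elim: ps ps1 {ps3 gps tr} => [|p ps IH] ps1; first by exists 0%N.
  have [|C HC] := IH; first by move=> q qps; apply: ps1; rewrite inE qps orbT.
  have pM : act g (circle_pi p.1) - circle_pi p.1 \in M.
    by rewrite rpredB ?act_memL ?ps1 ?mem_head.
  have [a aE] := Ms pM.
  exists (\max_(j < m) absz (a j) + C)%N => q; rewrite inE => /orP[/eqP->|/HC].
    exists a => // j; apply: leq_trans _ (leq_addr _ _).
    exact: leq_bigmax.
  by apply: span_ballW; apply: leq_addl.
exists C => z; have [p pps zp] := ps3 _ (crd_itv z).
by rewrite (tr _ pps _ zp); apply: HC.
Qed.

(** The words [prod_i f_i ^ n_i] with [n_i < N] move [z] to at most
   [O (N ^ m)] points, whereas there are [N ^ m.+1] of them. *)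
Lemma word_collision (f : 'I_m.+1 -> IET_group M) z :
  exists N (n n' : {ffun 'I_m.+1 -> 'I_N}), n != n' /\
    act (\prod_i f i ^+ n i)%g z = act (\prod_i f i ^+ n' i)%g z.
Proof.
have /choice[C fC] i := moves_by_ex (f i).
pose D := (\sum_i C i)%N.
pose N := ((2 * D).+1 ^ m).+1; exists N.
pose w (n : {ffun 'I_m.+1 -> 'I_N}) := (\prod_i f i ^+ n i)%g.
have wD n : span_ball (N * D) (act (w n) z - z).
  suff H : moves_by (\sum_i n i * C i) (w n).
    apply: span_ballW (H z); rewrite big_distrr /=; apply: leq_sum => i _.
    by rewrite leq_mul2r ltnW ?orbT.
  apply: (big_ind2 (fun C g => moves_by C g)); first exact: moves_by1.
    by move=> *; apply: moves_byM.
  by move=> i _; apply: moves_byX.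
have /choice[a aE] : forall n, exists a : int ^ m,
    (forall j, (absz (a j) <= N * D)%N) /\ act (w n) z - z = \sum_(j < m) s`_j *~ a j.
  by move=> n; have [a] := wD n; exists a.
pose code n : {ffun 'I_m -> 'I_(2 * (N * D)).+1} :=
  [ffun j => inord (absz (a n j + (N * D)%N%:Z))].
have /injectivePn[n [n' nn' cE]] : ~~ injectiveb code.
  apply/negP => /injectiveP/leq_card; rewrite !card_ffun !card_ord.
  apply/negP; rewrite -ltnNge.
  apply: (@leq_ltn_trans (((2 * D).+1 * N) ^ m)).
    have leq_expr k u v : (u <= v)%N -> (u ^ k <= v ^ k)%N.
      by move=> uv; elim: k => // k IH; rewrite !expnS leq_mul.
    by apply: leq_expr; have : (0 < N)%N by []; nia.
  by rewrite expnMn expnS ltn_pmul2r ?expn_gt0// /N ltnSn.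
exists n, n'; split=> //.
apply: (addIr (- z)); have [an ->] := aE n; have [an' ->] := aE n'.
apply: eq_bigr => j _; congr (_ *~ _).
have : code n j = code n' j by rewrite cE.
rewrite !ffunE => /(congr1 val); rewrite /= !inordK.
- by move: (a n j) (a n' j) (N * D)%N (an j) (an' j) => u v W; lia.
- by move: (a n' j) (N * D)%N (an' j) => v W; lia.
- by move: (a n j) (N * D)%N (an j) => u W; lia.
Qed.

End Pigeonhole.

(** * Irrational rotations *)

Section Irrational.
Variables (R : realType) (L : zmodClosed (circle R)).
Hypotheses (Lfg : finitely_generated L) (Ld : dense_subgroup L).
Implicit Types (a b l q y : R) (z : circle R).

(** Otherwise a multiple of the finitely generated group [lifts L] would be
   contained in the discrete group generated by [l]. *)
Lemma irrational_ex l : l \in lifts L -> 0 < l ->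
  exists b, [/\ b \in lifts L, 0 < b, b < l &
    forall (n : nat) (k : int), (0 < n)%N -> n%:R * b != k%:~R * l].
Proof.
move=> lL l0.
suff [b bL bl] : exists2 b, b \in lifts L &
    forall (n : nat) (k : int), (0 < n)%N -> n%:R * b != k%:~R * l.
  pose f := Num.floor (b / l).
  have fE : b - f%:~R * l \in lifts L.
    by apply: liftsB => //; rewrite mulrzl; apply: liftsMz.
  have irr (n : nat) (k : int) : (0 < n)%N -> n%:R * (b - f%:~R * l) != k%:~R * l.
    move=> n0; apply: contra (bl n (k + n%:Z * f) n0) => /eqP E.
    by rewrite intrD intrM -[n%:~R]/(n%:R) mulrDl -E mulrBr mulrA subrK.
  have /andP[f1 f2] := floor_itv (b / l).
  rewrite -/f ler_pdivlMr// in f1; rewrite -/f ltr_pdivrMr// intrD mulrDl mul1r in f2.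
  exists (b - f%:~R * l); split=> //; last by lra.
  have := irr 1%N 0 isT; rewrite mul1r mul0r lt_neqAle eq_sym => ->/=; lra.
apply: contrapT => nex.
have {nex} com b : b \in lifts L -> exists n : nat, (0 < n)%N /\
    exists k : int, n%:R * b = k%:~R * l.
  move=> bL; apply: contrapT => nb; apply: nex; exists b => // n k n0.
  by apply/eqP => E; apply: nb; exists n; split => //; exists k.
have [m [s sE]] := Lfg.
pose sg (j : 'I_m) : R := crd s`_j.
have sgL j : sg j \in lifts L.
  rewrite crd_lifts; apply/sE; exists [ffun i => (i == j)%:Z].
  rewrite (bigD1 j)//= big1 ?addr0 ?ffunE ?eqxx// => i ij.
  by rewrite ffunE (negbTE ij).
have /choice[n nE] := fun j => com _ (sgL j).
have [n1 [n10 [k1 k1E]]] := com _ (lifts1 L).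
pose N := (n1 * \prod_j n j)%N.
have N0 : (0 < N)%N by rewrite muln_gt0 n10 prodn_gt0// => j; have [] := nE j.
have dv (d : nat) b : (d %| N)%N -> (exists k : int, d%:R * b = k%:~R * l) ->
    exists k : int, N%:R * b = k%:~R * l.
  move=> /dvdnP[e ->] [k E]; exists (e%:Z * k).
  by rewrite natrM -mulrA E mulrA intrM.
have sum_dv (r : seq 'I_m) (c : 'I_m -> int) : exists k : int,
    N%:R * (\sum_(j <- r) sg j *~ c j) = k%:~R * l.
  elim: r => [|j r [k IH]]; first by exists 0; rewrite big_nil mulr0 mul0r.
  have [|kj kjE] := dv (n j) (sg j) _ (nE j).2.
    by rewrite /N (bigD1 j)//= dvdn_mull// dvdn_mulr.
  exists (kj * c j + k); rewrite big_cons mulrDr IH intrD mulrDl; congr (_ + _).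
  by rewrite -[sg j *~ _]mulrzr mulrA kjE intrM mulrAC.
have all_dv b : b \in lifts L -> exists k : int, N%:R * b = k%:~R * l.
  move=> /sE[c bc].
  have : circle_pi b = circle_pi (\sum_j sg j *~ c j).
    rewrite bc; apply: (big_ind2 (fun u v => u = circle_pi v)).
    - by rewrite circle_pi0.
    - by move=> u v u' v' -> ->; rewrite circle_piD.
    move=> j _; rewrite -[s`_j]crdK -/(sg j).
    have natE (e : nat) : circle_pi (sg j) *+ e = circle_pi (sg j *+ e).
      elim: e => [|e IH]; first by rewrite circle_pi0.
      by rewrite !mulrS [RHS]circle_piD; congr (_ + _).
    by case: (c j) => e; rewrite ?NegzE ?mulrNz ?circle_piN -?pmulrn natE.
  move=> /circle_piE/intrP[e be].
  have [k kE] := sum_dv (index_enum _) c.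
  have [|k' k'E] := dv n1 1 _ (ex_intro _ k1 k1E); first exact: dvdn_mulr.
  exists (k + k' * e); rewrite (_ : b = \sum_j sg j *~ c j + e%:~R);
    last by rewrite -be addrC subrK.
  rewrite mulrDr kE intrD mulrDl; congr (_ + _).
  by rewrite -[e%:~R]mul1r mulrA k'E intrM mulrAC.
have NR : 0 < (N%:R : R) by rewrite ltr0n.
have [|b bL /andP[b0 bl]] := @lifts_dense R L 0 (l / N%:R) Ld;
  first by rewrite divr_gt0.
have [k kE] := all_dv _ bL.
have h1 : (0 : int)%:~R < k%:~R :> R.
  by rewrite -(ltr_pM2r l0) -kE mul0r mulr_gt0.
have h2 : k%:~R < (1 : int)%:~R :> R.
  by rewrite -(ltr_pM2r l0) -kE mul1r mulrC -ltr_pdivlMr.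
by move: h1 h2; rewrite !ltr_int; lia.
Qed.

Lemma irot_power a l b n : rot_ok L a l b -> 0 < l ->
  exists y, [/\ 0 <= y, y < l, (exists k : int, n%:R * b = y + k%:~R * l) &
    forall z, crd (act (irot L a l b ^+ n)%g z) = rotF a l y (crd z)].
Proof.
move=> ok l0; have [a0 b0 bl al _] := ok.
elim: n => [|n [y [y0 yl [k yk] yE]]].
  exists 0; split=> //; first by exists 0; rewrite !mul0r addr0.
  by move=> z; rewrite expg0 act1; case: rotFP; lra.
have [yb|yb] := ltrP (y + b) l.
  exists (y + b); split=> //; first by lra.
    by exists k; rewrite -natr1 mulrDl yk mul1r addrAC.
  move=> z; rewrite expgS actM rotE// yE.
  move: (crd z) => x; clear -y0 yl yb b0 bl l0.
  have [xa|ax] := ltrP x a; first by rewrite !rotFlow.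
  have [xl|lx] := ltrP x (a + l); last by rewrite !rotFhigh.
  have [x1|x1] := ltrP (x + y) (a + l); last first.
    rewrite [rotF a l y x]rotFright; [|lra..].
    rewrite rotFleft; [|lra..].
    by rewrite rotFright; lra.
  rewrite [rotF a l y x]rotFleft; [|lra..].
  have [x2|x2] := ltrP (x + y + b) (a + l).
    by rewrite !rotFleft; lra.
  by rewrite !rotFright; lra.
exists (y + b - l); split=> //; [lra|lra| |].
  exists (k + 1); rewrite -natr1 mulrDl yk mul1r intrD mulrDl mul1r; lra.
move=> z; rewrite expgS actM rotE// yE.
move: (crd z) => x; clear -y0 yl yb b0 bl l0.
have [xa|ax] := ltrP x a; first by rewrite !rotFlow.
have [xl|lx] := ltrP x (a + l); last by rewrite !rotFhigh.
have [x1|x1] := ltrP (x + y) (a + l).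
  rewrite [rotF a l y x]rotFleft; [|lra..].
  rewrite rotFright; [|lra..].
  by rewrite rotFleft; lra.
rewrite [rotF a l y x]rotFright; [|lra..].
have [x2|x2] := ltrP (x + y - l + b) (a + l).
  by rewrite !rotFleft; lra.
by rewrite !rotFright; lra.
Qed.

(** The multiples of the distance from [y] to the nearest multiple of [4 * q]
   advance by steps of at most [2 * q], the length of the middle half, and so
   cannot jump over it. *)
Lemma middle_multiple q y : 0 < y -> y < 4 * q ->
  exists (j : nat) (k : int), (0 < j)%N /\ q <= j%:R * y - k%:~R * (4 * q) <= 3 * q.
Proof.
move=> y0 yq.
have mid d : 0 < d -> d <= 2 * q ->
    exists j : nat, (0 < j)%N /\ q <= j%:R * d <= 3 * q.
  move=> d0 dq; have q0 : 0 < q by lra.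
  have ex : exists j : nat, q <= j%:R * d.
    exists (Num.truncn (q / d)).+1; rewrite -ler_pdivrMr//; apply: ltW.
    exact: truncnS_gt.
  case: (ex_minnP ex) => -[|j] jq jmin; first by rewrite mul0r in jq; lra.
  exists j.+1; split=> //; rewrite jq /=.
  have : j%:R * d < q by rewrite ltNge; apply/negP => /jmin; rewrite ltnn.
  by rewrite -natr1 mulrDl; lra.
have [yq2|qy2] := lerP y (2 * q).
  have [j [j0 jE]] := mid _ y0 yq2.
  by exists j, 0; split=> //; rewrite mul0r subr0.
have [||j [j0 /andP[j1 j2]]] := mid (4 * q - y); [lra|lra|].
exists j, (j%:Z - 1); split=> //; rewrite intrB -[j%:~R]/(j%:R).
by apply/andP; split; lra.
Qed.

(** By irrationality [r ^+ n] is a rotation by a nonzero angle; a power of it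
   has its angle in the middle half, so that the first quarter leaves itself. *)
Lemma quarter_push a q b n : rot_ok L a (4 * q) b -> 0 < q -> (0 < n)%N ->
    (forall (n : nat) (k : int), (0 < n)%N -> n%:R * b != k%:~R * (4 * q)) ->
  exists2 j, (0 < j)%N &
    forall z, itv a q z -> ~ itv a q (act (irot L a (4 * q) b ^+ (j * n))%g z).
Proof.
move=> ok q0 n0 irr; have q4 : 0 < 4 * q by lra.
have [y [y0 yq [k yk] _]] := irot_power n ok q4.
have {}y0 : 0 < y.
  rewrite lt_neqAle y0 andbT eq_sym; apply: contraTN isT => /eqP yz.
  by have := irr n k n0; rewrite yk yz add0r eqxx.
have [j [k' [j0 /andP[jk1 jk2]]]] := middle_multiple y0 yq.
exists j => // z /andP[z1 z2].
have [t [t0 tq [k'' tk] tE]] := irot_power (j * n) ok q4.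
have tj : t = j%:R * y - k'%:~R * (4 * q).
  have [u uE] : exists u, u = j%:R * y - k'%:~R * (4 * q) by eexists.
  rewrite -uE in jk1 jk2 *.
  have E : t - u = (j%:Z * k + k' - k'')%:~R * (4 * q).
    have -> : t = j%:R * (y + k%:~R * (4 * q)) - k''%:~R * (4 * q).
      by rewrite -yk mulrA -natrM tk addrK.
    by rewrite uE !(intrD, intrB, intrM) -[j%:~R]/(j%:R); ring.
  suff K0 : j%:Z * k + k' - k'' = 0 by move: E; rewrite K0 mul0r => /subr0_eq.
  move: (j%:Z * k + k' - k'') E => K E.
  have h1 : (-1)%:~R < K%:~R :> R.
    by rewrite -(ltr_pM2r q4) -E mulrNz mulN1r; lra.
  have h2 : K%:~R < (1 : int)%:~R :> R.
    by rewrite -(ltr_pM2r q4) -E mul1r; lra.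
  by move: h1 h2; rewrite !ltr_int; lia.
rewrite /itv /= tE rotFleft; [|lra..].
by move=> /andP[]; lra.
Qed.

End Irrational.

(** * Transport and division of 3-cycles *)

Section Cycles.
Variables (R : realType) (L : zmodClosed (circle R)).
Implicit Types (g h : IET_group L) (a b p l s t : R).

Definition cyc_in p l a s :=
  [/\ p <= a, 0 < s, a + 3 * s <= p + l, a \in lifts L & s \in lifts L].

Lemma cyc_in_ok p l a s : 0 <= p -> p + l <= 1 -> cyc_in p l a s -> cyc_ok L a s.
Proof. by move=> p0 pl [pa s0 sl aL sL]; split=> //; lra. Qed.

Lemma sub_itv p l a s z : p <= a -> a + s <= p + l -> itv (R := R) a s z -> itv p l z.
Proof. by move=> pa sl /andP[az zs]; apply/andP; split; lra. Qed.

Lemma cyc_in_supp p l a s : 0 <= p -> p + l <= 1 -> cyc_in p l a s ->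
  supp_in (itv p l) (cyc L a s).
Proof.
move=> p0 pl ain; have ok := cyc_in_ok p0 pl ain.
have [pa s0 sl _ _] := ain.
by apply: sub_supp_in (cyc_supp ok) => z; apply: sub_itv.
Qed.

(** The conjugating element is a rotation of the interval that both 3-cycles
   span. *)
Lemma cyc_transport p l a b s : 0 <= p -> p + l <= 1 ->
    cyc_in p l a s -> cyc_in p l b s ->
  exists2 h, supp_in (itv p l) h & (cyc L a s = h * cyc L b s * h^-1)%g.
Proof.
move=> p0 pl.
have H a' b' : a' <= b' -> cyc_in p l a' s -> cyc_in p l b' s ->
    exists2 h, supp_in (itv p l) h & (h * cyc L a' s = cyc L b' s * h)%g.
  move=> ab ain bin; have [pa s0 sl aL sL] := ain; have [pb _ tl bL _] := bin.
  exists (irot L a' (b' - a' + 3 * s) (b' - a')); last first.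
    by apply: cyc_conj => //; [exact: cyc_in_ok ain|exact: cyc_in_ok bin].
  apply: (@sub_supp_in _ _ (itv a' (b' - a' + 3 * s))) => [z|];
    first by apply: sub_itv => //; lra.
  by apply: rot_supp; split; try lra; split; in_lifts.
move=> ain bin; have [ab|/ltW ba] := lerP a b.
  have [h hI E] := H _ _ ab ain bin; exists h^-1%g; first exact: supp_inV.
  by rewrite -mulgA invgK -E mulKg.
have [h hI E] := H _ _ ba bin ain; exists h => //.
by rewrite E mulgK.
Qed.

Lemma cyc_divide p l a s t : 0 <= p -> p + l <= 1 -> 0 < s -> 0 < t ->
    s \in lifts L -> t \in lifts L -> cyc_in p l a (s + t) ->
  exists2 h, supp_in (itv p l) h &
    (cyc L a (s + t) = h * (cyc L a s * cyc L (a + 3 * s) t) * h^-1)%g.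
Proof.
move=> p0 pl s0 t0 sL tL ain; have ok := cyc_in_ok p0 pl ain.
have [pa _ stl aL _] := ain.
have E := cyc_split ok (ltW s0) (ltW t0) sL tL.
move: E; set h := (_ * irot _ _ _ _)%g => E.
exists h^-1%g; last by rewrite -mulgA invgK -E mulKg.
apply: supp_inV; apply: supp_inM.
  apply: (@sub_supp_in _ _ (itv (a + 2 * s) (2 * t + s))) => [z|];
    first by apply: sub_itv; lra.
  by apply: rot_supp; split; try lra; split; in_lifts.
apply: (@sub_supp_in _ _ (itv (a + s) (t + s))) => [z|]; first by apply: sub_itv; lra.
by apply: rot_supp; split; try lra; split; in_lifts.
Qed.

(** All the short 3-cycles of the interval are conjugate to those given, and a
   long 3-cycle is conjugate to a product of short ones. *)
Lemma cyc_generate (N : IET_group L -> Prop) p l e :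
  dense_subgroup L -> 0 <= p -> p + l <= 1 -> 0 < e ->
  (forall g h, N g -> N h -> N (g * h)%g) ->
  (forall g h, supp_in (itv p l) h -> N g -> N (h * g * h^-1)%g) ->
  (forall t, t \in lifts L -> 0 < t -> t <= e ->
     exists2 b, cyc_in p l b t & N (cyc L b t)) ->
  forall a s, cyc_in p l a s -> N (cyc L a s).
Proof.
move=> Ld p0 pl e0 NM NJ Ne.
have small a t : t <= e -> cyc_in p l a t -> N (cyc L a t).
  move=> te ain; have [_ t0 _ _ tL] := ain.
  have [b bin Nb] := Ne _ tL t0 te.
  by have [h hI ->] := cyc_transport p0 pl ain bin; apply: NJ.
have [t tL /andP[t0 te]] := lifts_dense Ld e0.
have H n a s : s <= n%:R * t -> cyc_in p l a s -> N (cyc L a s).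
  elim: n a s => [|n IH] a s sn ain; have [pa s0 sl aL sL] := ain.
    by rewrite mul0r in sn; lra.
  have [st|ts] := lerP s t; first by apply: small => //; lra.
  have sE : t + (s - t) = s by rewrite addrC subrK.
  have stL : s - t \in lifts L by apply: liftsB.
  have st0 : 0 < s - t by lra.
  rewrite -sE in ain *.
  have [h hI ->] := cyc_divide p0 pl t0 st0 tL stL ain.
  apply: NJ => //; apply: NM.
    by apply: small; [exact: ltW|split=> //; lra].
  apply: IH; first by rewrite -natr1 mulrDl mul1r in sn; lra.
  split=> //; try lra; in_lifts.
move=> a s ain; have [n sn] : exists n : nat, s <= n%:R * t.
  exists (Num.truncn (s / t)).+1; rewrite -ler_pdivrMr//; apply: ltW.
  exact: truncnS_gt.
exact: H sn ain.
Qed.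

End Cycles.

(** * Boundedly many disjoint intervals act near a point *)

Section Finiteness.
Variables (R : realType) (L M : zmodClosed (circle R)).
Hypotheses (Lfg : finitely_generated L) (Ld : dense_subgroup L).
Variable phi : {multiplicative IET_group L -> IET_group M}.
Implicit Types (g h : IET_group L) (x z : circle R) (E : set (circle R)).

Definition psi g x := act (phi g) x.

Lemma phi1 : phi 1%g = 1%g.
Proof. by apply: (mulgI (phi 1%g)); rewrite -gmulfM !mulg1. Qed.

Lemma phiX g n : phi (g ^+ n)%g = (phi g ^+ n)%g.
Proof. by elim: n => [|n IH]; rewrite ?phi1// !expgS gmulfM IH. Qed.

Lemma psiM g h x : psi (g * h)%g x = psi g (psi h x).
Proof. by rewrite /psi gmulfM actM. Qed.
Lemma psi1 x : psi 1%g x = x.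
Proof. by rewrite /psi phi1. Qed.
Lemma psiK g x : psi g^-1%g (psi g x) = x.
Proof. by rewrite -psiM mulVg psi1. Qed.
Lemma psiKV g x : psi g (psi g^-1%g x) = x.
Proof. by rewrite -psiM mulgV psi1. Qed.
Lemma psiV_fix g x : psi g x = x -> psi g^-1%g x = x.
Proof. by move=> gx; rewrite -{1}gx psiK. Qed.

Variables (m : nat) (s : m.-tuple (circle R)).
Hypothesis Ms : forall z, z \in M -> inIntSpan s z.

(** Dividing two words that agree at [x] yields an element [w] fixing [x], which
   acts as a nontrivial power of [r i] where the exponents of [r i] differ. *)
Lemma word_relation (E : 'I_m.+1 -> set (circle R)) (r : 'I_m.+1 -> IET_group L) x :
  (forall i j z, i != j -> E i z -> E j z -> False) ->
  (forall i, supp_in (E i) (r i)) ->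
  exists i d w, [/\ (0 < d)%N, psi w x = x,
    forall z, E i z -> act w z = act (r i ^+ d)%g z &
    forall F, (forall j z, E j z -> F z) -> supp_in F w].
Proof.
move=> Edis rE.
have [N [n [n' [nn' nE]]]] := word_collision Ms (fun i => phi (r i)) x.
pose W (n : {ffun 'I_m.+1 -> 'I_N}) := (\prod_i r i ^+ n i)%g.
have WE (k : {ffun 'I_m.+1 -> 'I_N}) : act (\prod_i phi (r i) ^+ k i)%g x = psi (W k) x.
  have phM : {morph phi : g h / (g * h)%g} by exact: gmulfM.
  rewrite /psi /W (big_morph _ phM phi1); congr (act _ _).
  by apply: eq_bigr => i _; rewrite phiX.
rewrite !WE in nE.
have WF k (F : set _) : (forall j z, E j z -> F z) -> supp_in F (W k).
  move=> EF; apply: (big_ind (fun g => supp_in F g)) => //.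
    by move=> g h; apply: supp_inM.
  by move=> j _; apply: supp_inX; apply: sub_supp_in (rE j) => z; apply: EF.
have WA k i z : E i z -> act (W k) z = act (r i ^+ k i)%g z.
  by move=> Ez; apply: (act_prod_disj Edis) Ez => j; apply: supp_inX.
have H k k' i : psi (W k) x = psi (W k') x -> (k' i < k i)%N ->
    exists i d w, [/\ (0 < d)%N, psi w x = x,
    forall z, E i z -> act w z = act (r i ^+ d)%g z &
    forall F, (forall j z, E j z -> F z) -> supp_in F w].
  move=> kE ki; exists i, (k i - k' i)%N, ((W k')^-1 * W k)%g; split.
  - by rewrite subn_gt0.
  - by rewrite psiM kE psiK.
  - move=> z Ez; apply: (@act_inj _ _ (W k'));
    rewrite actM actKV (WA _ _ _ Ez) (WA k' i).
      by rewrite -actM -expgnDr subnKC// ltnW.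
    by apply: supp_in_act => //; apply: supp_inX.
  - by move=> F EF; apply: supp_inM; [apply: supp_inV|]; apply: WF.
have [i ni] : exists i, n i != n' i.
  apply/existsP; apply: contraNT nn'; rewrite negb_exists => /forallP ne.
  by apply/eqP/ffunP => i; apply/eqP; have := ne i; rewrite negbK.
have [lt|lt|/val_inj eq] := ltngtP (n i) (n' i).
- exact: (H n' n i).
- exact: (H n n' i).
- by rewrite eq eqxx in ni.
Qed.

Lemma conj_commute g h u : (u * g = g * u)%g ->
  ((h * u) * g * (h * u)^-1 = h * g * h^-1)%g.
Proof. by move=> ug; rewrite invgM -!mulgA (mulgA u) ug -mulgA mulVKg. Qed.

(** This is the projection to the elements supported in [E] of the stabiliser of
   [x] in the group of the products of elements supported in or off [E]. *)
Definition fixed_mod E x g :=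
  supp_in E g /\ exists2 u, supp_in (~` E) u & psi (g * u)%g x = x.

Lemma fixed_modM E x g h : fixed_mod E x g -> fixed_mod E x h ->
  fixed_mod E x (g * h)%g.
Proof.
move=> [gE [u uE gu]] [hE [v vE hv]]; split; first exact: supp_inM.
exists (u * v)%g; first exact: supp_inM.
have uh : (u * h = h * u)%g by apply: supp_commute uE hE => z; apply.
by rewrite -mulgA (mulgA h) -uh -mulgA (mulgA g) psiM hv.
Qed.

Lemma fixed_modV E x g : fixed_mod E x g -> fixed_mod E x g^-1%g.
Proof.
move=> [gE [u uE gu]]; split; first exact: supp_inV.
exists u^-1%g; first exact: supp_inV.
have gu' : (u * g = g * u)%g by apply: supp_commute uE gE => z; apply.
by rewrite -invgM gu'; apply: psiV_fix.
Qed.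

Lemma fixed_modX E x g n : fixed_mod E x g -> fixed_mod E x (g ^+ n)%g.
Proof.
move=> gE; elim: n => [|n IH]; last by rewrite expgS; apply: fixed_modM.
split; first exact: supp_in1.
by exists 1%g; [exact: supp_in1|rewrite mulg1 psi1].
Qed.

(** Otherwise each [E i] supports an element [r i] that violates the conclusion,
   and the relation between the [r i] at [x] contradicts this for some [i]. *)
Lemma power_fixed_mod (E : 'I_m.+1 -> set (circle R)) x :
  (forall i j z, i != j -> E i z -> E j z -> False) ->
  exists i, forall r, supp_in (E i) r ->
    exists2 n, (0 < n)%N & fixed_mod (E i) x (r ^+ n)%g.
Proof.
move=> Edis; apply: contrapT => nE.
have /choice[r rE] i : exists r, supp_in (E i) r /\
    forall n, (0 < n)%N -> ~ fixed_mod (E i) x (r ^+ n)%g.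
  apply: contrapT => nr; apply: nE; exists i => r rE; apply: contrapT => nn.
  by apply: nr; exists r; split=> // n n0 f; apply: nn; exists n.
have [i [d [w [d0 wx wE _]]]] := word_relation x Edis (fun i => (rE i).1).
apply: ((rE i).2 d d0); split; first by apply: supp_inX; exact: (rE i).1.
exists ((r i ^+ d)^-1 * w)%g; last by rewrite mulgA mulgV mul1g.
move=> z /contrapT Ez; rewrite actM wE//.
by rewrite actK.
Qed.

(** Let [J] be the first quarter of [A]. If [r ^+ n] pushes [J] off itself and
   if both [r ^+ n] and its conjugate by [h] fix [x] up to elements supported
   off [A], so does [h * (r ^+ n * h^-1 * r ^- n)], which acts on [J] as
   [h] does. *)
Lemma fixer_normal a q x : 0 <= a -> 0 < q -> a + 4 * q <= 1 ->
    a \in lifts L -> q \in lifts L ->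
    (forall r, supp_in (itv a (4 * q)) r ->
      exists2 n, (0 < n)%N & fixed_mod (itv a (4 * q)) x (r ^+ n)%g) ->
  forall g h, supp_in (itv a q) g -> supp_in (itv a q) h ->
    psi g x = x -> psi (h * g * h^-1)%g x = x.
Proof.
move=> a0 q0 aq aL qL Apow g h gJ hJ gx.
have q4L : 4 * q \in lifts L by apply: liftsMnat.
have q40 : 0 < 4 * q by lra.
have JA z : itv a q z -> itv (R := R) a (4 * q) z by apply: sub_itv; lra.
have [b [bL b0 bq irr]] := irrational_ex Lfg Ld q4L q40.
have ok : rot_ok L a (4 * q) b by split; try lra.
set r := irot L a (4 * q) b.
have rA : supp_in (itv a (4 * q)) r by apply: rot_supp.
have hA : supp_in (itv a (4 * q)) h by apply: sub_supp_in hJ.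
have [n1 n10 P1] := Apow _ rA.
have rhA : supp_in (itv a (4 * q)) (h * r * h^-1)%g.
  by apply: supp_inM; [apply: supp_inM|apply: supp_inV].
have [n2 n20 P2] := Apow _ rhA.
have n0 : (0 < n1 * n2)%N by rewrite muln_gt0 n10.
have [j j0 push] := quarter_push ok q0 n0 irr.
set n := (j * (n1 * n2))%N in push.
have Pr : fixed_mod (itv a (4 * q)) x (r ^+ n)%g.
  have -> : n = (n1 * (j * n2))%N by rewrite /n mulnCA.
  by rewrite expgnA; apply: fixed_modX.
have Ph : fixed_mod (itv a (4 * q)) x (h * r ^+ n * h^-1)%g.
  have -> : (h * r ^+ n * h^-1 = (h * r * h^-1) ^+ n)%g.
    elim: (n) => [|k IH]; first by rewrite !expg0 mulg1 mulgV.
    by rewrite !expgS -IH !mulgA mulgVK.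
  have -> : n = (n2 * (j * n1))%N by rewrite /n mulnA mulnC.
  by rewrite expgnA; apply: fixed_modX.
have [pA [u uA pux]] := fixed_modM Ph (fixed_modV Pr).
set p := (_ / _)%g in pA pux.
set h' := (r ^+ n * h^-1 * (r ^+ n)^-1)%g.
have pE : p = (h * h')%g by rewrite /p /h' !mulgA.
have h'g : (h' * g = g * h')%g.
  apply: (@supp_commute _ _ [set z | itv a q (act (r ^+ n)^-1%g z)] (itv a q)) gJ.
    move=> z /= Jz; have := push _ Jz; rewrite actKV; exact.
  by move=> z /= nJ; rewrite !actM (supp_inV hJ)// actKV.
have ug : (u * g = g * u)%g.
  by apply: supp_commute uA gJ => z nA /JA.
have -> : (h * g * h^-1 = (p * u) * g * (p * u)^-1)%g.
  by rewrite conj_commute// pE conj_commute.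
by rewrite psiM (psiV_fix pux) psiM gx.
Qed.

(** The conjugate [w * p * w^-1] is supported off [V], so that the commutator of
   [w] and [p], which lies in [N], acts on [V] as [p^-1]; hence its commutator
   with [q] is that of [p^-1] and [q]. *)
Lemma commutator_trick (N : IET_group L -> Prop) (J V : set (circle R)) w p q :
  (forall g h, N g -> N h -> N (g * h)%g) -> (forall g, N g -> N g^-1%g) ->
  (forall g h, supp_in J h -> N g -> N (h * g * h^-1)%g) ->
  (forall z, V z -> J z) -> N w -> (forall z, V z -> ~ V (act w z)) ->
  supp_in V p -> supp_in V q -> N (p^-1 * q * p * q^-1)%g.
Proof.
move=> NM NV NJ VJ Nw wV pV qV.
have pJ := sub_supp_in VJ pV; have qJ := sub_supp_in VJ qV.
pose p' := (w * p * w^-1)%g.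
have Nc : N (p' * p^-1)%g.
  rewrite /p' (_ : _ * _ = w * (p * w^-1 * p^-1))%g; last by rewrite !mulgA.
  by apply: NM => //; apply: NJ => //; apply: NV.
have : N (p' * p^-1 * (q * (p' * p^-1)^-1 * q^-1))%g.
  by apply: NM => //; apply: NJ => //; apply: NV.
congr N; rewrite invgM invgK.
have kE : (p' * (p^-1 * q * p) = p^-1 * q * p * p')%g.
  apply: (@supp_commute _ _ [set z | V (act w^-1%g z)] V).
  - by move=> z /= Vz; have := wV _ Vz; rewrite actKV; exact.
  - by move=> z /= nV; rewrite !actM (pV _ nV) actKV.
  by apply: supp_inM; [apply: supp_inM => //; apply: supp_inV|].
rewrite (_ : _ * _ = (p' * (p^-1 * q * p)) * p'^-1 * q^-1)%g; last by rewrite !mulgA.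
by rewrite kE mulgK.
Qed.

(** For the [i] of [power_fixed_mod], the stabiliser of [x] among the elements
   supported in the [i]-th quarter is normal there, by [fixer_normal], and not
   trivial, by [word_relation]; commutators then produce 3-cycles in it. *)
Lemma active_bound x (a q : 'I_m.+1 -> R) :
  (forall i, [/\ 0 <= a i, 0 < q i, a i + 4 * q i <= 1, a i \in lifts L &
     q i \in lifts L]) ->
  (forall i j z, i != j ->
     itv (a i) (4 * q i) z -> itv (R := R) (a j) (4 * q j) z -> False) ->
  exists i, forall b t, cyc_in L (a i) (q i) b t -> psi (cyc L b t) x = x.
Proof.
move=> aq Adis.
have [i Apow] := power_fixed_mod x Adis; exists i.
have [a0 q0 aq1 aL qL] := aq i.
move: (a i) (q i) a0 q0 aq1 aL qL Apow => {Adis aq i} {}a {}q a0 q0 aq aL qL Apow.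
have nrm := fixer_normal a0 q0 aq aL qL Apow.
pose N g := supp_in (itv a q) g /\ psi g x = x.
have NM g h : N g -> N h -> N (g * h)%g.
  by move=> [gJ gx] [hJ hx]; split; [exact: supp_inM|rewrite psiM hx].
have NV g : N g -> N g^-1%g.
  by move=> [gJ gx]; split; [exact: supp_inV|exact: psiV_fix].
have NJ g h : supp_in (itv a q) h -> N g -> N (h * g * h^-1)%g.
  move=> hJ [gJ gx]; split; last exact: nrm.
  by apply: supp_inM; [apply: supp_inM|apply: supp_inV].
(* A relation between irrational rotations of [m.+1] disjoint subintervals
   yields a nontrivial element of [N]. *)
have m0 : 0 < m.+1%:R :> R by rewrite ltr0n.
have [l lL /andP[l0 lq]] : exists2 l, l \in lifts L & 0 < l < q / m.+1%:R.
  by apply: lifts_dense => //; rewrite divr_gt0.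
rewrite ltr_pdivlMr// mulrC in lq.
have [b [bL b0 bl irr]] := irrational_ex Lfg Ld lL l0.
pose c (j : 'I_m.+1) := a + j%:R * l.
have cL j : c j \in lifts L by in_lifts.
have jl (j : 'I_m.+1) : 0 <= j%:R * l /\ j%:R * l + l <= m.+1%:R * l.
  split; first by rewrite mulr_ge0// ltW.
  by rewrite -[X in _ + X]mul1r -mulrDl natr1 ler_pM2r// ler_nat.
have cok j : rot_ok L (c j) l b.
  by have [? ?] := jl j; rewrite /c; split; try lra; split=> //; apply: cL.
have cdis i j z : i != j -> itv (c i) l z -> itv (R := R) (c j) l z -> False.
  have H (i' j' : 'I_m.+1) : (i' < j')%N ->
      itv (c i') l z -> itv (R := R) (c j') l z -> False.
    move=> ij /andP[_ h1] /andP[h2 _].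
    have : i'%:R * l + l <= j'%:R * l.
      by rewrite -[X in _ + X]mul1r -mulrDl natr1 ler_pM2r// ler_nat.
    by rewrite /c in h1 h2; lra.
  move=> /eqP ij hi hj; have [lt|lt|/val_inj//] := ltngtP i j.
    exact: H lt hi hj.
  exact: H lt hj hi.
have [i [d [w [d0 wx wE wF]]]] := word_relation x cdis (fun j => rot_supp (cok j)).
have Nw : N w.
  split=> //; apply: wF => j z; have [? ?] := jl j.
  by apply: sub_itv; rewrite /c; lra.
have [y [y0 yl [k yk] yE]] := irot_power d (cok i) l0.
have {}y0 : 0 < y.
  rewrite lt_neqAle y0 andbT eq_sym; apply: contraTN isT => /eqP yz.
  by have := irr d k d0; rewrite yk yz add0r eqxx.
(* On [c i, c i + l[ it is a nontrivial rotation, which pushes a small interval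
   off itself. *)
pose v := Num.min y (l - y).
have [vy vl] : v <= y /\ v <= l - y by rewrite /v !ge_min !lexx orbT.
have v0 : 0 < v by rewrite /v lt_min y0; lra.
have [ci1 ci2] := jl i.
have VE z : itv (c i) v z -> itv (R := R) (c i) l z by apply: sub_itv; lra.
have VJ z : itv (c i) v z -> itv (R := R) a q z by apply: sub_itv; rewrite /c; lra.
have push z : itv (c i) v z -> ~ itv (c i) v (act w z).
  move=> Vz; have /andP[z1 z2] := Vz; rewrite /itv /= wE; last exact: VE.
  rewrite yE rotFleft; [|lra..].
  by move=> /andP[]; lra.
have a1 : a + q <= 1 by lra.
have v3 : 0 < v / 3 by rewrite divr_gt0.
suff cycN : forall b' t, cyc_in L a q b' t -> N (cyc L b' t) by move=> b' t /cycN[].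
apply: (cyc_generate Ld a0 a1 v3 NM NJ) => t tL t0 tv.
have tin : cyc_in L a q (c i) t by split=> //; rewrite /c; lra.
have tok := cyc_in_ok a0 a1 tin.
exists (c i) => //.
have ok1 : rot_ok L (c i) (2 * t) t.
  by have [? ? ? ? ?] := tok; split; try lra; split; in_lifts.
have ok2 : rot_ok L (c i + t) (2 * t) t.
  by have [? ? ? ? ?] := tok; split; try lra; split; in_lifts.
set P := irot L (c i) (2 * t) t in ok1; set Q := irot L (c i + t) (2 * t) t in ok2.
have PV : supp_in (itv (c i) v) P.
  by apply: sub_supp_in (rot_supp ok1) => z; apply: sub_itv; lra.
have QV : supp_in (itv (c i) v) Q.
  by apply: sub_supp_in (rot_supp ok2) => z; apply: sub_itv; lra.
have := commutator_trick NM NV NJ VJ Nw push QV PV.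
rewrite cyc_comm// -/P -/Q.
have -> : (Q^-1 = Q)%g by apply: mulg1_eq; apply: rot_invol.
have -> : (P^-1 = P)%g by apply: mulg1_eq; apply: rot_invol.
by rewrite !mulgA.
Qed.

End Finiteness.

(** * Length of finite unions of intervals *)

Section Length.
Variables (R : realType) (M : zmodClosed (circle R)).
Implicit Types (g h : IET_group M) (E F : set (circle R)) (z : circle R)
  (ps : seq (R * R)).

Definition crd_set E : set R := [set x | 0 <= x < 1 /\ E (circle_pi x)].

Definition len E : R := fine (lebesgue_measure (crd_set E)).

Definition pieces ps :=
  (forall p, p \in ps ->
     [/\ 0 <= p.1, p.1 < p.2, p.2 <= 1, p.1 \in lifts M & p.2 \in lifts M]) /\
  pairwise (@apart R) ps.

Definition covers ps E :=
  forall z, E z <-> exists2 p, p \in ps & p.1 <= crd z < p.2.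

Definition tame E := exists2 ps, pieces ps & covers ps E.

Lemma apart_disj (p q : R * R) x : apart p q -> p.1 <= x < p.2 -> q.1 <= x < q.2 ->
  False.
Proof. by move=> /orP[] h /andP[? ?] /andP[? ?]; lra. Qed.

Lemma len_pieces ps E : pieces ps -> covers ps E ->
  measurable (crd_set E) /\
  lebesgue_measure (crd_set E) = (\sum_(p <- ps) (p.2 - p.1))%:E.
Proof.
elim: ps E => [|p ps IH] E [ps1 ps2] Eps.
  have -> : crd_set E = set0.
    by apply/seteqP; split=> // x [_ /Eps[]].
  by rewrite big_nil measure0.
move: ps2 => /= /andP[pps ps2].
pose F := [set z | exists2 q, q \in ps & q.1 <= crd z < q.2].
have [||Fm FE] := IH F.
- by split=> // q qps; apply: ps1; rewrite inE qps orbT.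
- by move=> z.
have [p0 pp p1 _ _] := ps1 _ (mem_head _ _).
have EU : crd_set E = `[p.1, p.2[%classic `|` crd_set F.
  apply/seteqP; split=> x.
    move=> [x01 /Eps[q]]; rewrite piK// inE => /orP[/eqP->|qps] xq.
      by left; rewrite /= in_itv.
    by right; split=> //; exists q; rewrite ?piK.
  case=> [|[x01 [q qps]]].
    rewrite /= in_itv /= => /andP[px xp].
    have x01 : 0 <= x < 1 by apply/andP; split; lra.
    by split=> //; apply/Eps; exists p; rewrite ?mem_head// piK// px.
  by rewrite piK// => xq; split=> //; apply/Eps; exists q;
    rewrite ?inE ?qps ?orbT// piK.
have Im : measurable (`[p.1, p.2[%classic : set R) by [].
split; first by rewrite EU; apply: measurableU.
rewrite EU measureU//; last first.
  apply/seteqP; split=> // x []; rewrite /= in_itv /= => xp [x01 [q qps]].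
  by rewrite piK// => xq; apply: apart_disj xp xq; apply: (allP pps).
rewrite -[LHS]/(lebesgue_measure `[p.1, p.2[%classic + lebesgue_measure (crd_set F))%E.
by rewrite FE lebesgue_measure_itv /= lte_fin pp big_cons EFinD.
Qed.

Lemma lenE ps E : pieces ps -> covers ps E -> len E = \sum_(p <- ps) (p.2 - p.1).
Proof. by move=> pso Eps; rewrite /len (len_pieces pso Eps).2. Qed.

Lemma len_ge0 E : tame E -> 0 <= len E.
Proof.
move=> [ps pso Eps]; rewrite (lenE pso Eps) big_seq; apply: sumr_ge0 => p pps.
by have [_ pp _ _ _] := pso.1 _ pps; rewrite subr_ge0 ltW.
Qed.

Lemma len_gt0 E z : tame E -> E z -> 0 < len E.
Proof.
move=> [ps pso Eps] /Eps[p pps _]; rewrite (lenE pso Eps).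
rewrite (big_rem p)//= ltr_pwDl//.
  by have [_ pp _ _ _] := pso.1 _ pps; rewrite subr_gt0.
rewrite big_seq; apply: sumr_ge0 => q /mem_rem qps.
by have [_ qq _ _ _] := pso.1 _ qps; rewrite subr_ge0 ltW.
Qed.

Lemma len_lifts E : tame E -> len E \in lifts M.
Proof.
move=> [ps [ps1 ps2] Eps]; rewrite (lenE _ Eps)//.
elim: ps ps1 {ps2 Eps} => [|p ps IH] ps1; first by rewrite big_nil lifts0.
rewrite big_cons liftsD//; last by apply: IH => q qps; apply: ps1; rewrite inE qps orbT.
by have [_ _ _ pL pL'] := ps1 _ (mem_head _ _); apply: liftsB.
Qed.

Lemma len_le1 E : tame E -> len E <= 1.
Proof.
move=> [ps pso Eps]; have [Em EE] := len_pieces pso Eps.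
rewrite (lenE pso Eps) -lee_fin -EE.
rewrite (_ : 1%:E = lebesgue_measure (`[0, 1[%classic : set R)).
  by apply: le_measure; rewrite ?inE// => x [x01 _]; rewrite /= in_itv.
by rewrite lebesgue_measure_itv /= lte_fin ltr01 oppr0 adde0.
Qed.

Lemma lenU E F : tame E -> tame F -> (forall z, E z -> F z -> False) ->
  tame (E `|` F) /\ len (E `|` F) = len E + len F.
Proof.
move=> [ps [ps1 ps2] Eps] [qs [qs1 qs2] Fqs] EF.
have pqs : pieces (ps ++ qs).
  split; first by move=> p; rewrite mem_cat => /orP[/ps1|/qs1].
  rewrite pairwise_cat ps2 qs2 !andbT; apply/allrelP => p q pps qqs.
  have [p0 pp p1 _ _] := ps1 _ pps; have [q0 qq q1 _ _] := qs1 _ qqs.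
  rewrite /apart; apply: contrapT => /negP; rewrite negb_or -!ltNge => /andP[qp pq].
  pose x := Num.max p.1 q.1.
  have xp : p.1 <= x < p.2 by rewrite /x le_max lexx /= gt_max pp.
  have xq : q.1 <= x < q.2 by rewrite /x le_max lexx orbT /= gt_max qq andbT.
  have x01 : 0 <= x < 1 by case/andP: xp => *; apply/andP; split; lra.
  by apply: (EF (circle_pi x)); [apply/Eps; exists p|apply/Fqs; exists q]; rewrite ?piK.
have cpq : covers (ps ++ qs) (E `|` F).
  move=> z; split=> [[/Eps|/Fqs] [p pps zp]|[p]].
  - by exists p; rewrite // mem_cat pps.
  - by exists p; rewrite // mem_cat pps orbT.
  by rewrite mem_cat => /orP[pps|pqs'] zp; [left; apply/Eps|right; apply/Fqs]; exists p.
split; first by exists (ps ++ qs).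
by rewrite (lenE pqs cpq) big_cat /= -(lenE _ Eps)// -(lenE _ Fqs).
Qed.

Lemma tame_eq E F : (forall z, E z <-> F z) -> E = F.
Proof. by move=> EF; apply/seteqP; split=> z /EF. Qed.

Lemma subdivision_tame ps E : subdivision M ps ->
  (forall p, p \in ps -> forall x, p.1 <= x < p.2 ->
     E (circle_pi x) <-> E (circle_pi p.1)) ->
  pieces [seq p <- ps | `[< E (circle_pi p.1) >]] /\
  covers [seq p <- ps | `[< E (circle_pi p.1) >]] E.
Proof.
move=> [ps1 ps2 ps3] Eps; split; first split.
- by move=> p; rewrite mem_filter => /andP[_]; apply: ps1.
- exact: pairwise_filter.
move=> z; split=> [Ez|[p]].
  have [p pps zp] := ps3 _ (crd_itv z); exists p => //.
  by rewrite mem_filter pps andbT; apply/asboolP/(Eps _ pps _ zp); rewrite crdK.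
rewrite mem_filter => /andP[/asboolP Ep pps] zp.
by move/(Eps _ pps _ zp): Ep; rewrite crdK.
Qed.

(** Sets described by the order of the coordinates of finitely many images of
   the point are unions of pieces on which these images move in parallel. *)
Lemma order_tame (gs : seq (IET_group M)) E :
  (forall z z', (forall g h, g \in gs -> h \in gs ->
      (crd (act g z) < crd (act h z)) = (crd (act g z') < crd (act h z'))) ->
    E z -> E z') -> tame E.
Proof.
move=> Egs; have [|ps pso [_ gps]] := @iet_pieces _ _ gs [::]; first by [].
have [] := @subdivision_tame ps E pso; last by move=> *; eexists; eassumption.
move=> p pps x xp; split; apply: Egs => g h ggs hgs.
  by rewrite (gps g p ggs pps x xp) (gps h p hgs pps x xp) ltrD2r.
by rewrite (gps g p ggs pps x xp) (gps h p hgs pps x xp) ltrD2r.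
Qed.

(** On a fine enough subdivision [g] translates the pieces of [E]. *)
Lemma tame_image g E : tame E ->
  tame [set z | E (act g^-1%g z)] /\ len [set z | E (act g^-1%g z)] = len E.
Proof.
move=> [ps [ps1 ps2] Eps].
have [|rs rso [rsD grs]] := @iet_pieces _ _ [:: g] (map fst ps ++ map snd ps).
  by move=> d; rewrite mem_cat => /orP[] /mapP[p pps ->]; have [] := ps1 _ pps.
have rsE r : r \in rs -> forall x, r.1 <= x < r.2 ->
    E (circle_pi x) <-> E (circle_pi r.1).
  have [rs1 _ _] := rso; move=> rrs x xr; have [r0 rr r1 _ _] := rs1 _ rrs.
  have x01 : 0 <= x < 1 by case/andP: xr => *; apply/andP; split; lra.
  have r01 : 0 <= r.1 < 1 by apply/andP; split; lra.
  have H y y' : r.1 <= y < r.2 -> r.1 <= y' < r.2 -> 0 <= y < 1 -> 0 <= y' < 1 ->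
      E (circle_pi y) -> E (circle_pi y').
    move=> yr yr' y01 y01' /Eps[p pps]; rewrite piK// => yp.
    apply/Eps; exists p => //; rewrite piK//.
    have := rsD r p.1 rrs; rewrite mem_cat map_f// => /(_ isT) h1.
    have := rsD r p.2 rrs; rewrite mem_cat [X in _ || X]map_f// orbT => /(_ isT) h2.
    move: yr yr' yp => /andP[? ?] /andP[? ?] /andP[? ?].
    move: h1 h2; rewrite !negb_and -!leNgt => /orP[] ? /orP[] ?; apply/andP; split; lra.
  by split; apply: H => //; rewrite lexx.
have [fo fc] := subdivision_tame rso rsE.
set fs := [seq p <- rs | `[< E (circle_pi p.1) >]] in fo fc.
pose im (r : R * R) : R * R :=
  (crd (act g (circle_pi r.1)), crd (act g (circle_pi r.1)) + (r.2 - r.1)).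
have gfs r : r \in fs -> forall x, r.1 <= x < r.2 ->
    crd (act g (circle_pi x)) = crd (act g (circle_pi r.1)) + (x - r.1).
  by rewrite mem_filter => /andP[_ rrs]; apply: grs; rewrite ?mem_head.
(* Hence the images of distinct pieces are apart, as the pieces are. *)
have imP r : r \in fs -> forall z, (im r).1 <= crd z < (im r).2 ->
    r.1 <= crd (act g^-1%g z) < r.2.
  move=> rfs z /andP[]; rewrite /im /= => z1 z2; have [r0 rr r1 _ _] := fo.1 _ rfs.
  pose x := r.1 + (crd z - crd (act g (circle_pi r.1))).
  have xr : r.1 <= x < r.2 by apply/andP; split; rewrite /x; lra.
  have -> : act g^-1%g z = circle_pi x.
    apply: (@act_inj _ _ g); rewrite actKV; apply/crd_inj.
    by rewrite (gfs _ rfs _ xr) /x; ring.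
  by rewrite piK//; case/andP: xr => *; apply/andP; split; lra.
have imo : pieces (map im fs).
  split=> [p /mapP[r rfs ->]|].
    have [r0 rr r1 rL rL'] := fo.1 _ rfs; rewrite /im /=; split.
    - exact: crd_ge0.
    - lra.
    - have lt1 := crd_lt1 (act g (circle_pi r.1)).
      rewrite leNgt; apply/negP => gt1.
      have xr : r.1 <= r.1 + (1 - crd (act g (circle_pi r.1))) < r.2 by apply/andP;
        split; lra.
      have := gfs _ rfs _ xr;
        have := crd_lt1 (act g (circle_pi (r.1 + (1 - crd (act g (circle_pi r.1)))))).
      lra.
    - by rewrite crd_lifts act_memL.
    - by apply: liftsD; [rewrite crd_lifts act_memL|apply: liftsB].
  rewrite pairwise_map; have [fs1 fs2] := fo.
  apply: (sub_in_pairwise (P := mem fs)) fs2; last by apply/allP.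
  move=> r r' /= rfs rfs' rr'; rewrite /apart; apply: contrapT => /negP.
  have [r0 rr r1 _ _] := fs1 _ rfs; have [r0' rr0' r1' _ _] := fs1 _ rfs'.
  rewrite negb_or -!ltNge => /andP[h1 h2].
  pose x := Num.max (im r).1 (im r').1.
  have xr : (im r).1 <= x < (im r).2.
    by rewrite /x le_max lexx /= gt_max h1 andbT /im /=; lra.
  have xr' : (im r').1 <= x < (im r').2.
    by rewrite /x le_max lexx orbT /= gt_max h2 /im /=; lra.
  have x01 : 0 <= x < 1.
    rewrite /x le_max gt_max /im /= crd_ge0 !crd_lt1//.
  have := apart_disj rr' (imP _ rfs (circle_pi x) _) (imP _ rfs' (circle_pi x) _).
  by rewrite piK//; apply.
have imc : covers (map im fs) [set z | E (act g^-1%g z)].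
  move=> z; split=> [/= /fc[r rfs zr]|[p /mapP[r rfs ->] zp]].
    exists (im r); first exact: map_f.
    have := gfs _ rfs _ zr; rewrite crdK actKV => ->; rewrite /im /=.
    by case/andP: zr => *; apply/andP; split; lra.
  by apply/fc; exists r => //; apply: imP.
split; first by exists (map im fs).
rewrite (lenE imo imc) (lenE fo fc) big_map; apply: eq_bigr => r _.
by rewrite /im /=; ring.
Qed.

(** The points moved by an element of order 3 fall into orbits of size 3; [t] is
   the length of the set of the points of least coordinate in their orbits. *)
Lemma len_order3 g (W : set (circle R)) (ks : seq (IET_group M)) :
  (g * (g * g) = 1)%g -> (forall z, W (act g z) <-> W z) ->
  (forall z z', (forall k h, k \in ks -> h \in ks ->
      (crd (act k z) < crd (act h z)) = (crd (act k z') < crd (act h z'))) ->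
    W z -> W z') ->
  exists2 t, t \in lifts M & len [set z | W z /\ act g z <> z] = 3 * t.
Proof.
move=> g3 Wg Wks.
have g3z z : act g (act g (act g z)) = z by rewrite -[RHS](@act1 _ M) -g3 !actM.
pose T := [set z | W z /\ crd z < crd (act g z) /\ crd z < crd (act g (act g z))].
have Tt : tame T.
  apply: (@order_tame ([:: 1%g; g; (g * g)%g] ++ ks)) => z z' zz' [Wz [h1 h2]].
  split; first by apply: Wks Wz => k h kks hks; apply: zz';
    rewrite mem_cat ?kks ?hks orbT.
  split.
    by have := zz' 1%g g; rewrite !act1 !inE !eqxx !orbT => <-.
  by have := zz' 1%g (g * g)%g; rewrite !act1 !actM !inE !eqxx !orbT => <-.
exists (len T); first exact: len_lifts.
have [T1 L1] := tame_image g Tt.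
have [T2 L2] := tame_image (g * g)%g Tt.
set E1 := [set z | T _] in T1 L1; set E2 := [set z | T _] in T2 L2.
have gi z : act g^-1%g z = act g (act g z).
  by apply: (@act_inj _ _ g); rewrite actKV g3z.
have ggi z : act (g * g)^-1%g z = act g z.
  by apply: (@act_inj _ _ (g * g)%g); rewrite actKV actM g3z.
have E1E z : E1 z <-> W z /\ crd (act g (act g z)) < crd z /\
    crd (act g (act g z)) < crd (act g z).
  by rewrite /E1 /T /= gi !g3z !Wg.
have E2E z : E2 z <-> W z /\ crd (act g z) < crd (act g (act g z)) /\
    crd (act g z) < crd z.
  by rewrite /E2 /T /= ggi !g3z !Wg.
have [|U1 LU1] := lenU Tt T1.
  by move=> z [_ [h1 h2]] /E1E[_ [h3 h4]]; have := lt_trans h2 h3; rewrite ltxx.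
have [|U2 LU2] := lenU U1 T2.
  move=> z [[_ [h1 h2]]|/E1E[_ [h1 h2]]] /E2E[_ [h3 h4]].
    by have := lt_trans h1 h4; rewrite ltxx.
  by have := lt_trans h2 h3; rewrite ltxx.
rewrite (_ : [set z | _] = T `|` E1 `|` E2).
  by rewrite LU2 LU1 L1 L2; ring.
apply: tame_eq => z; split=> [[Wz gz]|].
  have n1 : crd (act g z) != crd z by apply/eqP => /crd_inj.
  have n2 : crd (act g (act g z)) != crd (act g z).
    by apply/eqP => /crd_inj/act_inj.
  have n3 : crd (act g (act g z)) != crd z.
    by apply/eqP => /crd_inj E; apply: gz; rewrite -{1}E g3z.
  have [h1|h1|/eqP] := ltgtP (crd z) (crd (act g z));
    last by rewrite eq_sym (negbTE n1).
    have [h2|h2|/eqP] := ltgtP (crd z) (crd (act g (act g z)));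
      last by rewrite eq_sym (negbTE n3).
      by left; left.
    by left; right; apply/E1E; split=> //; split=> //; exact: lt_trans h2 h1.
  have [h2|h2|/eqP] := ltgtP (crd (act g z)) (crd (act g (act g z)));
    last by rewrite eq_sym (negbTE n2).
    by right; apply/E2E.
  by left; right; apply/E1E; split=> //; split=> //; exact: lt_trans h2 h1.
case=> [[[Wz [h1 h2]]|/E1E[Wz [h1 h2]]]|/E2E[Wz [h1 h2]]]; split=> // E.
- by rewrite E ltxx in h1.
- by rewrite !E ltxx in h1.
- by rewrite !E ltxx in h2.
Qed.

End Length.

(** * Families of disjoint 3-cycles acting near a common point *)

Section Families.
Variables (R : realType) (L M : zmodClosed (circle R)).
Hypotheses (Lfg : finitely_generated L) (Ld : dense_subgroup L).
Variable phi : {multiplicative IET_group L -> IET_group M}.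
Implicit Types (g h : IET_group L) (x z : circle R) (u v : R * R)
  (F : seq (R * R)) (b t : R).

Local Notation psi := (psi phi).

(** A pair [u] stands for the contiguous 3-cycle of length [u.2] at [u.1]. *)
Definition cyc2 u := cyc L u.1 u.2.
Definition itv2 u : set (circle R) := itv u.1 (3 * u.2).
Definition cyc2_in u v := cyc_in L u.1 (3 * u.2) v.1 v.2.
Definition sep u v := (u.1 + 3 * u.2 <= v.1) || (v.1 + 3 * v.2 <= u.1).

Definition cyc_family F := [/\ uniq F, forall u, u \in F -> cyc_in L 0 1 u.1 u.2 &
  forall u v, u \in F -> v \in F -> u != v -> sep u v].

Definition moved F x := forall u, u \in F -> psi (cyc2 u) x <> x.

Lemma sepC u v : sep u v = sep v u. Proof. by rewrite /sep orbC. Qed.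

Lemma sep_disj u v z : sep u v -> itv2 u z -> itv2 v z -> False.
Proof. by move=> /orP[] h /andP[? ?] /andP[? ?]; lra. Qed.

Lemma sep_sub u v w : cyc2_in u w -> sep u v -> sep w v.
Proof. by move=> [? ? ? _ _] /orP[] ?; apply/orP; [left|right]; lra. Qed.

Lemma cyc2_in01 u v : cyc_in L 0 1 u.1 u.2 -> cyc2_in u v -> cyc_in L 0 1 v.1 v.2.
Proof. by move=> [? ? ? _ _] [? ? ? ? ?]; split=> //; lra. Qed.

Lemma cyc2_supp u v : cyc_in L 0 1 u.1 u.2 -> cyc2_in u v ->
  supp_in (itv2 u) (cyc2 v).
Proof.
by move=> [? ? ? _ _] uv; apply: cyc_in_supp uv => //; lra.
Qed.

Lemma cyc2_in_refl u : cyc_in L 0 1 u.1 u.2 -> cyc2_in u u.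
Proof. by move=> [? ? ? ? ?]; split=> //; lra. Qed.

Lemma cyc2_supp1 u : cyc_in L 0 1 u.1 u.2 -> supp_in (itv2 u) (cyc2 u).
Proof. by move=> u01; apply: cyc2_supp => //; apply: cyc2_in_refl. Qed.

Lemma cyc_family_perm F F' : perm_eq F F' -> cyc_family F -> cyc_family F'.
Proof.
move=> FF' [uF cF sF]; split; first by rewrite -(perm_uniq FF').
  by move=> u; rewrite -(perm_mem FF'); apply: cF.
by move=> u v; rewrite -!(perm_mem FF'); apply: sF.
Qed.

Lemma moved_perm F F' x : perm_eq F F' -> moved F x -> moved F' x.
Proof. by move=> FF' Fx u; rewrite -(perm_mem FF'); apply: Fx. Qed.

Lemma moved_cons u F x : moved (u :: F) x <-> psi (cyc2 u) x <> x /\ moved F x.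
Proof.
split=> [H|[ux Fx] v]; last by rewrite inE => /orP[/eqP->|/Fx].
by split=> [|v vF]; apply: H; rewrite inE ?eqxx// vF orbT.
Qed.

Lemma cyc_family_cons u F : cyc_family (u :: F) <->
  [/\ cyc_in L 0 1 u.1 u.2, cyc_family F & forall v, v \in F -> sep u v].
Proof.
split=> [[/= /andP[uF unF] cF sF]|[u01 [unF cF sF] suF]].
  split=> [||v vF].
  - by apply: cF; rewrite mem_head.
  - split=> // [v vF|v w vF wF]; first by apply: cF; rewrite inE vF orbT.
    by apply: sF; rewrite inE ?vF ?wF orbT.
  - apply: sF; rewrite ?mem_head// ?inE ?vF ?orbT//.
    by apply: contraNneq uF => ->.
split=> [|v|v w].
- rewrite /= unF andbT; apply/negP => /suF.
  by have [_ u0 _ _ _] := u01; rewrite /sep => /orP[] ?; lra.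
- by rewrite inE => /orP[/eqP->//|/cF].
rewrite !inE => /orP[/eqP->|vF] /orP[/eqP->|wF]; rewrite ?eqxx// => vw.
- exact: suF.
- by rewrite sepC; apply: suF.
- exact: sF.
Qed.

Lemma cyc_family_sub u v F : cyc_family (u :: F) -> cyc2_in u v -> cyc_family (v :: F).
Proof.
move=> /cyc_family_cons[u01 Ff uF] uv; apply/cyc_family_cons; split=> //.
  exact: cyc2_in01 uv.
by move=> w wF; apply: sep_sub uv _; apply: uF.
Qed.

Lemma psi_inj g : injective (psi g).
Proof. exact: act_inj. Qed.

Lemma psi_comm (E E' : set (circle R)) g h x : (forall z, E z -> E' z -> False) ->
  supp_in E g -> supp_in E' h -> psi g (psi h x) = psi h (psi g x).
Proof. by move=> EE gE hE; rewrite -!psiM (supp_commute EE gE hE). Qed.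

(** [h] commutes with the 3-cycles of [F]. *)
Lemma moved_invariant u F h x : cyc_family (u :: F) -> supp_in (itv2 u) h ->
  moved F (psi h x) <-> moved F x.
Proof.
move=> /cyc_family_cons[u01 [_ cF _] uF] hu.
have H v : v \in F -> psi (cyc2 v) (psi h x) = psi h (psi (cyc2 v) x).
  move=> vF; apply: (@psi_comm (itv2 v) (itv2 u)) => // [z|].
    by apply: sep_disj; rewrite sepC uF.
  exact/cyc2_supp1/cF.
split=> Fx v vF; have := Fx v vF; rewrite H//; first by move=> + E; rewrite E; apply.
by move=> + /psi_inj.
Qed.

(** Otherwise the short 3-cycles near [u] would fix all the points moved by [F];
   by [cyc_generate] so would [cyc2 u], which moves [x]. *)
Lemma moved_shrink u F x e : cyc_family (u :: F) -> moved (u :: F) x -> 0 < e ->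
  exists t, [/\ t \in lifts L, 0 < t, t <= e &
    forall v, cyc2_in u v -> v.2 = t -> exists x', moved (v :: F) x'].
Proof.
move=> uFf /moved_cons[ux Fx] e0.
have [u01 _ _] := (cyc_family_cons u F).1 uFf; have [u0 us0 us1 uL usL] := u01.
pose N g := supp_in (itv2 u) g /\ forall y, moved F y -> psi g y = y.
have NM g h : N g -> N h -> N (g * h)%g.
  move=> [gI gN] [hI hN]; split; first exact: supp_inM.
  by move=> y Fy; rewrite psiM hN// gN.
have NJ g h : supp_in (itv2 u) h -> N g -> N (h * g * h^-1)%g.
  move=> hI [gI gN]; have hVI := supp_inV hI.
  split; first by apply: supp_inM => //; apply: supp_inM.
  move=> y Fy; rewrite !psiM gN ?psiKV//.
  by apply/(moved_invariant _ uFf).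
apply: contrapT => nt; apply: ux.
suff : N (cyc2 u) by case=> _; apply.
have u31 : u.1 + 3 * u.2 <= 1 by lra.
apply: (cyc_generate Ld u0 u31 e0 NM NJ); last exact: cyc2_in_refl.
move=> t tL t0 te; apply: contrapT => nb; apply: nt; exists t; split=> // v uv vt.
apply: contrapT => nx; apply: nb; exists v.1; rewrite -vt//.
split; first exact: cyc2_supp uv.
move=> y Fy; apply: contrapT => vy; apply: nx; exists y.
exact/moved_cons.
Qed.

(** Shortening the 3-cycles one after the other makes the room that
   [active_bound] needs around each of them; the common moved point changes. *)
Lemma moved_roomy F G x : cyc_family (F ++ G) -> moved (F ++ G) x ->
  exists F' x', [/\ size F' = size F, cyc_family (F' ++ G), moved (F' ++ G) x' &
    forall i, (i < size F)%N -> (nth (0, 0) F' i).1 = (nth (0, 0) F i).1 /\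
      4 * (nth (0, 0) F' i).2 <= (nth (0, 0) F i).2].
Proof.
elim: F G x => [|u F IH] G x FG Fx; first by exists [::], x.
have p1 : perm_eq ((u :: F) ++ G) (F ++ u :: G).
  by rewrite perm_sym perm_catC /= perm_cons perm_catC.
have [F' [x' [F'F F'G F'x F'4]]] := IH _ _ (cyc_family_perm p1 FG) (moved_perm p1 Fx).
have p2 : perm_eq (F' ++ u :: G) (u :: F' ++ G).
  by rewrite perm_catC /= perm_cons perm_catC.
have uF'G := cyc_family_perm p2 F'G.
have [u01 _ _] := (cyc_family_cons _ _).1 uF'G; have [? us0 ? uL usL] := u01.
have e0 : 0 < u.2 / 4 by rewrite divr_gt0.
have [t [tL t0 te tx]] := moved_shrink uF'G (moved_perm p2 F'x) e0.
have uv : cyc2_in u (u.1, t) by split=> //=; lra.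
have [x'' vx''] := tx _ uv erefl.
exists ((u.1, t) :: F'), x''; split=> //.
- by rewrite /= F'F.
- exact: cyc_family_sub uF'G uv.
by case=> [|i] /=; [split=> //; lra|apply: F'4].
Qed.

Variables (m : nat) (s : m.-tuple (circle R)).
Hypothesis Ms : forall z, z \in M -> inIntSpan s z.

Lemma moved_size F x : cyc_family F -> moved F x -> (size F <= m)%N.
Proof.
move=> Ff Fx; rewrite leqNgt; apply/negP => mF.
have [||F' [x' [F'F F'f F'x F'4]]] := @moved_roomy F [::] x; rewrite ?cats0//.
rewrite cats0 in F'f F'x.
have iF (i : 'I_m.+1) : (i < size F)%N by apply: leq_trans (ltn_ord i) mF.
pose P (i : 'I_m.+1) := nth (0, 0) F i; pose P' (i : 'I_m.+1) := nth (0, 0) F' i.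
have PF i : P i \in F by apply: mem_nth.
have PF' i : P' i \in F' by apply: mem_nth; rewrite F'F.
clear F'F.
have [unF cF sF] := Ff; have [unF' cF' _] := F'f.
have P4 i : (P' i).1 = (P i).1 /\ 4 * (P' i).2 <= (P i).2 by apply: F'4.
have [i|i j z ij zi zj|i fx] := active_bound Lfg Ld phi Ms x'
    (a := fun i => (P' i).1) (q := fun i => 3 * (P' i).2).
- have [? ? ? ? ?] := cF' _ (PF' i); have [? ? ? ? ?] := cF _ (PF i).
  by have [E ?] := P4 i; split=> //; [lra|rewrite E; lra|in_lifts].
- have : sep (P i) (P j).
    by apply: sF => //; rewrite nth_uniq ?iF//.
  have [Ei hi] := P4 i; have [Ej hj] := P4 j.
  move: zi zj; rewrite /itv /= Ei Ej => /andP[? ?] /andP[? ?] /orP[] ?; lra.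
- apply: (F'x _ (PF' i)); apply: fx; have [? ? ? ? ?] := cF' _ (PF' i).
  by split=> //; lra.
Qed.

(** ** The length of the set moved by a 3-cycle *)

Definition moved_set F g := [set x | moved F x /\ psi g x <> x].

(** The order of the images of a point by these elements tells whether it is
   moved by the family. *)
Definition moved_elts F := (1%g : IET_group M) :: [seq phi (cyc2 u) | u <- F].

Lemma moved_order F z z' :
  (forall k k' : IET_group M, k \in moved_elts F -> k' \in moved_elts F ->
    (crd (act k z) < crd (act k' z)) = (crd (act k z') < crd (act k' z'))) ->
  moved F z -> moved F z'.
Proof.
move=> zz' Fz u uF uz'; apply: (Fz u uF); apply/crd_inj.
have m1 : 1%g \in moved_elts F by rewrite mem_head.
have mu : phi (cyc2 u) \in moved_elts F.
  by rewrite inE (map_f (fun u => phi (cyc2 u))) ?orbT.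
have := zz' _ _ m1 mu; have := zz' _ _ mu m1; rewrite !act1 -!/(psi _ _) uz' ltxx.
by case: ltgtP.
Qed.

Lemma moved_set_tame F g : tame M (moved_set F g).
Proof.
apply: (@order_tame _ _ (phi g :: moved_elts F)) => z z' zz' [Fz gz].
split.
  by apply: moved_order Fz => k h kF hF; apply: zz'; rewrite inE ?kF ?hF orbT.
move=> gz'; apply: gz; apply/crd_inj.
have m1 : 1%g \in phi g :: moved_elts F by rewrite !inE eqxx orbT.
have mg : phi g \in phi g :: moved_elts F by rewrite mem_head.
have := zz' _ _ m1 mg; have := zz' _ _ mg m1; rewrite !act1 -!/(psi _ _) gz' ltxx.
by case: ltgtP.
Qed.

Lemma phiV g : phi g^-1%g = (phi g)^-1%g.
Proof. by apply: (mulgI (phi g)); rewrite -gmulfM !mulgV phi1. Qed.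

(** [h] preserves the set of the points moved by [F], hence carries one of the
   two sets onto the other. *)
Lemma len_moved_conj u F g h : cyc_family (u :: F) -> supp_in (itv2 u) h ->
  len (moved_set F (h * g * h^-1)%g) = len (moved_set F g).
Proof.
move=> uF hu; have [_ <-] := tame_image (phi h) (moved_set_tame F g).
congr len; apply: tame_eq => z; rewrite /moved_set /= -phiV -!/(psi _ _).
rewrite (moved_invariant _ uF (supp_inV hu)) !psiM.
by split=> -[Fz hz]; split=> // E; apply: hz; rewrite ?E ?psiKV// -{2}E psiK.
Qed.

(** This is what the maximality of the size of [u :: F] provides. *)
Definition exclusive u F := forall v w x, cyc2_in u v -> cyc2_in u w -> sep v w ->
  ~ moved (v :: w :: F) x.

(** By [cyc_divide] the 3-cycle is conjugate to the product of the two shorter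
   ones, and by exclusivity a point moved by [F] is moved by at most one of
   these. *)
Lemma len_moved_add u F b t t' : cyc_family (u :: F) -> exclusive u F ->
  0 < t -> 0 < t' -> t \in lifts L -> t' \in lifts L ->
  cyc2_in u (b, t + t') ->
  len (moved_set F (cyc2 (b, t + t'))) =
    len (moved_set F (cyc2 (b, t))) + len (moved_set F (cyc2 (b + 3 * t, t'))).
Proof.
move=> uF exc t0 t0' tL tL' uv.
have [u01 _ _] := (cyc_family_cons u F).1 uF; have [u0 us0 us1 uL usL] := u01.
have u31 : u.1 + 3 * u.2 <= 1 by lra.
have [h hI E] := cyc_divide u0 u31 t0 t0' tL tL' uv.
rewrite {1}/cyc2 /= E (len_moved_conj _ uF hI).
have [/= ub _ tu bL _] := uv.
have v1 : cyc2_in u (b, t) by split=> //=; lra.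
have v2 : cyc2_in u (b + 3 * t, t') by split=> //=; try lra; in_lifts.
have s12 : sep (b, t) (b + 3 * t, t') by rewrite /sep /= lexx.
have exc12 z : moved F z -> psi (cyc2 (b, t)) z <> z ->
    psi (cyc2 (b + 3 * t, t')) z <> z -> False.
  move=> Fz h1 h2; apply: (exc _ _ z v1 v2 s12).
  by apply/moved_cons; split=> //; apply/moved_cons.
have comm z : psi (cyc2 (b, t)) (psi (cyc2 (b + 3 * t, t')) z) =
    psi (cyc2 (b + 3 * t, t')) (psi (cyc2 (b, t)) z).
  apply: (@psi_comm (itv2 (b, t)) (itv2 (b + 3 * t, t'))).
  - by move=> y; apply: sep_disj.
  - exact/cyc2_supp1/(cyc2_in01 u01 v1).
  - exact/cyc2_supp1/(cyc2_in01 u01 v2).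
have [|_ <-] := lenU (moved_set_tame F (cyc2 (b, t)))
    (moved_set_tame F (cyc2 (b + 3 * t, t'))).
  by move=> z [Fz h1] [_ h2]; apply: exc12 h1 h2.
congr len; apply: tame_eq => z; rewrite /moved_set /= psiM.
split=> [[Fz gz]|[[Fz gz]|[Fz gz]]].
- have [h1|h1] := pselect (psi (cyc2 (b, t)) z = z); last by left.
  by right; split=> // h2; apply: gz; rewrite [psi _ z]h2.
- split=> // E'; apply: (exc12 z Fz gz) => h2; apply: gz.
  by rewrite -[RHS]E' [psi (cyc _ _ _) z]h2.
- split=> //; rewrite -!/(cyc2 (_, _)) comm => E'.
  have [h1|h1] := pselect (psi (cyc2 (b, t)) z = z); last exact: exc12 h1 gz.
  by apply: gz; rewrite -{1}h1.
Qed.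

Lemma len_moved_third u v F : cyc_family (u :: F) -> cyc2_in u v ->
  exists2 t, t \in lifts M & len (moved_set F (cyc2 v)) = 3 * t.
Proof.
move=> uF uv; have [u01 _ _] := (cyc_family_cons u F).1 uF.
apply: (@len_order3 _ _ (phi (cyc2 v)) (moved F) (moved_elts F)).
- rewrite -!gmulfM -(phi1 phi); congr (phi _); apply: cyc3.
  have [? ? ? ? ?] := cyc2_in01 u01 uv; split=> //; lra.
- by move=> z; apply: (moved_invariant z uF); apply: cyc2_supp uv.
- exact: moved_order.
Qed.

End Families.

(** * From an embedding to a homothety *)

Section Linear.
Variables (R : realType) (L : zmodClosed (circle R)).
Hypothesis Ld : dense_subgroup L.
Implicit Types (s t e l : R).

(** An additive function is linear once it is nonnegative: [s] and [t] are
   compared with the multiples of a common small length [u]. *)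
Lemma additive_linear (mu : R -> R) l :
  (forall t, t \in lifts L -> 0 < t -> t <= l -> 0 <= mu t) ->
  (forall s t, s \in lifts L -> t \in lifts L -> 0 < s -> 0 < t -> s + t <= l ->
     mu (s + t) = mu s + mu t) ->
  forall s t, s \in lifts L -> t \in lifts L -> 0 < s -> 0 < t -> s <= l -> t <= l ->
    mu s * t = mu t * s.
Proof.
move=> mu0 muD.
have muB s u : s \in lifts L -> u \in lifts L -> 0 < u -> u < s -> s <= l ->
    mu s = mu u + mu (s - u).
  move=> sL uL u0 us sl; rewrite -muD ?liftsB ?subr_gt0//; first by rewrite addrC subrK.
  by rewrite addrC subrK.
have lower n u s : u \in lifts L -> 0 < u -> s \in lifts L -> 0 < s -> s <= l ->
    n%:R * u <= s -> n%:R * mu u <= mu s.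
  move=> uL u0; elim: n s => [|n IH] s sL s0 sl ns; first by rewrite mul0r mu0.
  rewrite -natr1 mulrDl mul1r in ns; rewrite -natr1 mulrDl mul1r.
  have n0 : 0 <= n%:R * u by rewrite mulr_ge0// ltW.
  have [us|su] := ltrP u s.
    have := IH (s - u); rewrite (muB s u)// liftsB// => /(_ isT).
    by move=> H; rewrite addrC lerD2l; apply: H; lra.
  have su' : u = s by lra.
  have nu0 : n%:R * u == 0 by rewrite eq_le n0 andbT; lra.
  move: nu0; rewrite mulf_eq0 (gt_eqF u0) orbF => /eqP ->.
  by rewrite mul0r add0r su'.
have upper n u s : u \in lifts L -> 0 < u -> u <= l -> s \in lifts L -> 0 < s ->
  s <= l ->
    s <= n%:R * u -> mu s <= n%:R * mu u.
  move=> uL u0 ul; elim: n s => [|n IH] s sL s0 sl sn; first by rewrite mul0r in sn;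
    lra.
  rewrite -natr1 mulrDl mul1r in sn; rewrite -natr1 mulrDl mul1r.
  have muu := mu0 _ uL u0 ul.
  have nmu : 0 <= n%:R * mu u by rewrite mulr_ge0.
  have [us|su|<-] := ltrgtP u s; last by rewrite lerDr.
    by rewrite (muB s u)// addrC lerD2r; apply: IH; rewrite ?liftsB//; lra.
  have us0 : 0 <= mu (u - s) by apply: mu0; rewrite ?liftsB//; lra.
  by rewrite (muB u s)// in nmu *; lra.
suff H s t : s \in lifts L -> t \in lifts L -> 0 < s -> 0 < t -> s <= l -> t <= l ->
    mu s * t <= mu t * s.
  by move=> s t *; apply/le_anti; rewrite !H.
move=> sL tL s0 t0 sl tl; rewrite leNgt; apply/negP; rewrite -subr_gt0.
set D := _ - _ => D0.
have ms := mu0 _ sL s0 sl; have mt := mu0 _ tL t0 tl.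
have e0 : 0 < Num.min t (D / (mu s + mu t + 1)).
  by rewrite lt_min t0 divr_gt0//; lra.
have [u uL /andP[u0]] := lifts_dense Ld e0.
rewrite lt_min => /andP[ut uD].
rewrite ltr_pdivlMr in uD; last by lra.
have ul : u <= l by lra.
have mu_u := mu0 _ uL u0 ul.
have su_ge0 : 0 <= s / u by rewrite divr_ge0// ltW.
have tu_ge0 : 0 <= t / u by rewrite divr_ge0// ltW.
have /andP[s1 s2] := truncn_itv su_ge0.
have /andP[t1 t2] := truncn_itv tu_ge0.
rewrite ler_pdivlMr// in s1; rewrite ltr_pdivrMr// in s2.
rewrite ler_pdivlMr// in t1; rewrite ltr_pdivrMr// in t2.
have up := upper _ _ _ uL u0 ul sL s0 sl (ltW s2).
have lo := lower _ _ _ uL u0 tL t0 tl t1.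
rewrite -natr1 mulrDl mul1r in t2; rewrite -natr1 mulrDl mul1r in up s2.
move: (Num.truncn (s / u))%:R (Num.truncn (t / u))%:R s1 s2 t1 t2 up lo =>
  a b s1 s2 t1 t2 up lo.
have up' : mu s * u <= (s + u) * mu u.
  rewrite (le_trans (ler_wpM2r (ltW u0) up))// [leLHS](_ : _ = (a * u + u) * mu u);
    last by ring.
  by rewrite ler_wpM2r// lerD2r.
have lo' : (t - u) * mu u <= mu t * u.
  rewrite (le_trans _ (ler_wpM2r (ltW u0) lo))// [leRHS](_ : _ = (b * u) * mu u);
    last by ring.
  by rewrite ler_wpM2r//; lra.
have tu0 : 0 < t - u by rewrite subr_gt0.
have : mu s * u * (t - u) <= (s + u) * (mu t * u).
  rewrite (le_trans (ler_wpM2r (ltW tu0) up'))// -mulrA ler_wpM2l//; first by lra.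
  by rewrite mulrC.
rewrite [leLHS](_ : _ = (mu s * (t - u)) * u); last by ring.
rewrite [leRHS](_ : _ = ((s + u) * mu t) * u); last by ring.
rewrite ler_pM2r// => fin.
have : D <= u * (mu s + mu t).
  by rewrite /D; move: fin; rewrite !mulrDl !mulrDr; lra.
by move: uD; rewrite mulrDr mulr1; lra.
Qed.

(** The elements of [lifts L] are sums and differences of small ones. *)
Lemma homothety_extend (M : zmodClosed (circle R)) c e : 0 < e ->
  (forall t, t \in lifts L -> 0 < t -> t <= e -> c * t \in lifts M) ->
  forall x, x \in lifts L -> c * x \in lifts M.
Proof.
move=> e0 ce; have [t tL /andP[t0 te]] := lifts_dense Ld e0.
have H n x : x \in lifts L -> 0 < x -> x <= n%:R * t -> c * x \in lifts M.
  elim: n x => [|n IH] x xL x0 xn; first by rewrite mul0r in xn; lra.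
  rewrite -natr1 mulrDl mul1r in xn.
  have [xt|tx] := lerP x t; first by apply: ce => //; lra.
  rewrite -[x](subrK t) mulrDr liftsD//; last by apply: ce => //; lra.
  by apply: IH; rewrite ?liftsB//; lra.
have pos x : x \in lifts L -> 0 < x -> c * x \in lifts M.
  move=> xL x0; apply: (H (Num.truncn (x / t)).+1) => //.
  by rewrite -ler_pdivrMr//; apply/ltW/truncnS_gt.
move=> x xL; have [x0|x0|->] := ltrgtP x 0.
- by rewrite -[x]opprK mulrN liftsN// pos ?liftsN// oppr_gt0.
- exact: pos.
- by rewrite mulr0 lifts0.
Qed.

End Linear.

Section EmbeddingHomothety.
Variables (R : realType) (L M : zmodClosed (circle R)).
Hypotheses (Lfg : finitely_generated L) (Ld : dense_subgroup L).
Variable phi : {multiplicative IET_group L -> IET_group M}.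
Implicit Types (x z : circle R) (u v : R * R) (F : seq (R * R)).

(** By conjugation the length of the moved set depends only on the length of the
   3-cycle; it is additive, hence linear, and a third of it is in [lifts M]. *)
Lemma family_homothety u F : cyc_family L (u :: F) -> exclusive phi u F ->
  (exists2 v, cyc2_in L u v & exists x, moved phi (v :: F) x) ->
  exists2 c, 0 < c & forall t, t \in lifts L -> 0 < t -> t <= u.2 ->
    c * t \in lifts M /\ len (moved_set phi F (cyc2 L (u.1, t))) = 3 * (c * t).
Proof.
move=> uF exc [v uv [x vx]].
have [u01 _ _] := (cyc_family_cons L u F).1 uF; have [u0 us0 us1 uL usL] := u01.
have u31 : u.1 + 3 * u.2 <= 1 by lra.
pose mu t := len (moved_set phi F (cyc2 L (u.1, t))).
have head t : t \in lifts L -> 0 < t -> t <= u.2 -> cyc2_in L u (u.1, t).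
  by move=> tL t0 tu; split=> //=; lra.
have muE w : cyc2_in L u w -> len (moved_set phi F (cyc2 L w)) = mu w.2.
  move=> uw; have [w1 w2 w3 w4 w5] := uw.
  have uw' : cyc2_in L u (u.1, w.2) by apply: head => //; lra.
  have [h hI E] := cyc_transport u0 u31 uw uw'.
  by rewrite {1}/cyc2 E (len_moved_conj phi _ uF hI).
have mu0 t : 0 <= mu t by apply/len_ge0/moved_set_tame.
have muD s t : s \in lifts L -> t \in lifts L -> 0 < s -> 0 < t -> s + t <= u.2 ->
    mu (s + t) = mu s + mu t.
  move=> sL tL s0 t0 st; rewrite {1}/mu (len_moved_add uF exc)//.
    by congr (_ + _); apply: (muE (u.1 + 3 * s, t)); split=> //=; try lra; in_lifts.
  by apply: head; [exact: liftsD|lra|].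
have [v1 v0 v2 vL vsL] := uv.
have vu : v.2 <= u.2 by lra.
have muv : 0 < mu v.2.
  rewrite -(muE v)//; apply: (@len_gt0 _ M _ x); first exact: moved_set_tame.
  by move/moved_cons: vx => [? ?].
have muL t : t \in lifts L -> 0 < t -> t <= u.2 -> mu t = 3 * (mu v.2 / (3 * v.2) * t).
  move=> tL t0 tu.
  have := additive_linear Ld (fun t _ _ _ => mu0 t) muD vsL tL v0 t0 vu tu.
  move=> E; rewrite (_ : _ * (_ * t) = mu v.2 * t / v.2); last first.
    by field; rewrite gt_eqF.
  by rewrite E mulfK// gt_eqF.
exists (mu v.2 / (3 * v.2)); first by rewrite divr_gt0//; lra.
move=> t tL t0 tu; split; last exact: muL.
have [t' tM' E] := len_moved_third phi uF (head _ tL t0 tu).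
have := muL _ tL t0 tu; rewrite {1}/mu E => /mulfI; rewrite pnatr_eq0 => /(_ isT) <-.
exact: tM'.
Qed.

Hypothesis phi_inj : injective phi.

Lemma moved_ex : exists u x, cyc_family L [:: u] /\ moved phi [:: u] x.
Proof.
have [t tL /andP[t0 t3]] : exists2 t, t \in lifts L & 0 < t < 1 / 3.
  by apply: lifts_dense => //; lra.
have t01 : cyc_in L 0 1 0 t by split; rewrite ?lifts0//; lra.
have tok : cyc_ok L 0 t by split; rewrite ?lifts0//; lra.
have nt : phi (cyc L 0 t) <> 1%g.
  rewrite -(phi1 phi) => /phi_inj/(congr1 (fun g => crd (act g 0))).
  have c0 : crd (0 : circle R) = 0 by rewrite -(circle_pi0 R) piK// lexx ltr01.
  by rewrite cycE// act1 c0 rotFleft; lra.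
have [x xt] : exists x, psi phi (cyc L 0 t) x <> x.
  apply: contrapT => nx; apply: nt; apply: iet_ext => z; rewrite act1.
  by congr crd; apply: contrapT => zx; apply: nx; exists z.
exists (0, t), x; split; first by apply/cyc_family_cons; split=> //; split.
exact/moved_cons.
Qed.

(** Any maximal family provides a homothety; the point is to make [c <= 1]. *)
Lemma embedding_homothety : finitely_generated M ->
  exists2 c : R, 0 < c <= 1 & forall x : R, x \in lifts L -> c * x \in lifts M.
Proof.
move=> [m [s sE]].
have Ms z : z \in M -> inIntSpan s z by move/sE.
pose P k := `[< exists F x, [/\ size F = k, cyc_family L F & moved phi F x] >].
have Pm k : P k -> (k <= m)%N.
  move=> /asboolP[F [x [<- Ff Fx]]]; exact: (moved_size Lfg Ld Ms Ff Fx).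
have [u0 [x0 [u0f u0x]]] := moved_ex.
have P1 : P 1%N by apply/asboolP; exists [:: u0], x0.
have [k Pk kmax] := ex_maxnP (ex_intro (fun k => P k) 1%N P1) Pm.
have exc u F : cyc_family L (u :: F) -> size (u :: F) = k -> exclusive phi u F.
  move=> uF uk v w x uv uw vw vwx.
  suff /kmax : P k.+1 by rewrite ltnn.
  apply/asboolP; exists [:: v, w & F], x; split=> //; first by rewrite /= -uk.
  have [u01 _ suF] := (cyc_family_cons L u F).1 uF.
  apply/cyc_family_cons; split; first exact: cyc2_in01 uv.
    exact: cyc_family_sub uF uw.
  move=> w'; rewrite inE => /orP[/eqP->//|w'F].
  by apply: sep_sub uv _; apply: suF.
case: k Pk kmax exc => [|[|k]] Pk kmax exc.
- by have := kmax _ P1.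
- (* All disjoint 3-cycles exclude each other, so the constant [c] found from the
     short ones is also that of 3-cycles of length close to 1/3. *)
  have [u01 _ _] := (cyc_family_cons L u0 [::]).1 u0f; have [a0 b0 ab aL bL] := u01.
  have zin t : t \in lifts L -> 0 < t -> 3 * t <= 1 -> cyc_in L 0 1 0 t.
    by move=> *; split; rewrite ?lifts0//; lra.
  have fam t : t \in lifts L -> 0 < t -> 3 * t <= 1 -> cyc_family L [:: (0, t)].
    by move=> tL t0 t3; apply/cyc_family_cons; split=> //; apply: zin.
  have v01 : cyc_in L 0 1 0 u0.2 by apply: zin => //; lra.
  have [x1 x1m] : exists x, moved phi [:: (0, u0.2)] x.
    have [|h _ E] := cyc_transport (lexx 0) _ u01 v01; first by rewrite add0r.
    exists (psi phi h^-1%g x0); apply/moved_cons; split=> // E'.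
    move/moved_cons: u0x => [+ _]; apply; rewrite /cyc2 E !psiM.
    by rewrite [psi _ (cyc _ _ _) _]E' psiKV.
  have hom t : t \in lifts L -> u0.2 <= t -> 3 * t <= 1 -> exists2 c, 0 < c &
      forall t', t' \in lifts L -> 0 < t' -> t' <= t ->
      c * t' \in lifts M /\ len (moved_set phi [::] (cyc2 L (0, t'))) = 3 * (c * t').
    move=> tL ut t3; apply: (@family_homothety (0, t) [::]).
    - by apply: fam => //; lra.
    - by apply: exc => //; apply: fam => //; lra.
    - exists (0, u0.2); last by exists x1.
      by split; rewrite ?lifts0//=; lra.
  have [||c c0 cE] := hom u0.2 bL; [lra|lra|].
  have cL := homothety_extend Ld b0 (fun t tL t0 tu => (cE t tL t0 tu).1).
  exists c => //; rewrite c0 /=.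
  have cu : 3 * (c * u0.2) <= 1.
    by rewrite -(cE u0.2 bL b0 (lexx _)).2; apply/(@len_le1 _ M)/moved_set_tame.
  rewrite leNgt; apply/negP => c1.
  have [t tL /andP[ct t3]] : exists2 t, t \in lifts L & 1 / (3 * c) < t < 1 / 3.
    by apply: lifts_dense => //; rewrite ltr_pdivrMr ?ltr_pdivlMr; lra.
  rewrite ltr_pdivrMr in ct; last by lra.
  have ut : u0.2 <= t by rewrite -(ler_pM2l c0); lra.
  have [|c' c0' cE'] := hom t tL ut; first by lra.
  have cc' : c' = c.
    have := (cE' _ bL b0 ut).2; rewrite (cE _ bL b0 (lexx _)).2 => E.
    have b0n : u0.2 != 0 by rewrite gt_eqF.
    by apply: (mulIf b0n); lra.
  have t0 : 0 < t by lra.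
  have : 3 * (c' * t) <= 1.
    by rewrite -(cE' t tL t0 (lexx _)).2; apply/(@len_le1 _ M)/moved_set_tame.
  rewrite cc'; lra.
(* [cv * t] is the length, up to the factor 3, of the set moved by all of [u],
   [w = (v.1, t)] and [F]; seen from [u] it is [c * u.2]. *)
move/asboolP: Pk => [[|u [|v F]] [x [sF Ff Fx]]] //.
have p : perm_eq [:: u, v & F] [:: v, u & F].
  by apply/permP => a /=; rewrite addnCA.
have vuF := cyc_family_perm p Ff; have vuFx := moved_perm p Fx.
have [u01 _ _] := (cyc_family_cons _ _ _).1 Ff;
  have [v01 _ _] := (cyc_family_cons _ _ _).1 vuF.
have [_ us0 _ _ usL] := u01; have [_ vs0 _ vL _] := v01.
have [||cv cv0 cvE] := family_homothety vuF.
- exact: exc.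
- by exists v; [exact: cyc2_in_refl|exists x].
have [t tL /andP[t0]] : exists2 t, t \in lifts L & 0 < t < Num.min v.2 (u.2 / cv).
  by apply: lifts_dense => //; rewrite lt_min vs0 divr_gt0.
rewrite lt_min => /andP[tv tu]; rewrite ltr_pdivlMr// in tu.
have [_ lenv] := cvE t tL t0 (ltW tv).
pose w := (v.1, t); rewrite -/w in lenv.
have vw : cyc2_in L v w by split=> //=; lra.
have wuF := cyc_family_sub vuF vw.
have p' : perm_eq [:: w, u & F] [:: u, w & F] by apply/permP => a /=; rewrite addnCA.
have uwF := cyc_family_perm p' wuF.
have swap : moved_set phi (w :: F) (cyc2 L u) = moved_set phi (u :: F) (cyc2 L w).
  apply: tame_eq => z; rewrite /moved_set /= !moved_cons.
  by split=> -[[? ?] ?].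
have [||c c0 cE] := family_homothety uwF.
- exact: exc.
- exists u; first exact: cyc2_in_refl.
  have : 0 < len (moved_set phi (u :: F) (cyc2 L w)).
    by rewrite lenv !mulr_gt0.
  move=> lpos; have [y [uy wy]] : moved_set phi (u :: F) (cyc2 L w) !=set0.
    apply: contrapT => ne; move: lpos.
    rewrite (_ : moved_set _ _ _ = set0); last by apply/seteqP; split=> // y my;
      apply: ne; exists y.
    rewrite (@lenE _ M [::]) ?big_nil ?ltxx//.
    by move=> z; split=> // -[].
  exists y; move/moved_cons: uy => [uy Fy]; apply/moved_cons; split=> //.
  exact/moved_cons.
exists c; last first.
  by apply: (homothety_extend Ld us0) => t' tL' t0' tu'; have [] := cE t' tL' t0' tu'.
have [_] := cE u.2 usL us0 (lexx _); rewrite -surjective_pairing swap lenv => E.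
by rewrite c0 /= -(ler_pM2r us0) mul1r; lra.
Qed.

End EmbeddingHomothety.

Theorem theorem1p9 (R : realType) (Lambda Delta : zmodClosed (circle R))
    (Lambda_fg : finitely_generated Lambda)
    (Delta_fg : finitely_generated Delta)
    (Lambda_dense : dense_subgroup Lambda)
    (Delta_dense : dense_subgroup Delta) :
  (exists phi : {multiplicative IET_group Lambda -> IET_group Delta},
     injective phi)
  <->
  (exists2 c : R, 0 < c <= 1 &
     forall x : R, x \in circle_preimage Lambda ->
       c * x \in circle_preimage Delta).
Proof.
split=> [[phi phi_inj]|[c c01 cLD]]; first exact: embedding_homothety phi_inj Delta_fg.
exact: homothety_embedding c01 cLD.
Qed.
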